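(* For a left subtractive semiring $S$ the following conditions are equivalent: (1) All finitely generated left $S$-semimodules are e-injective. (2) All cyclic left $S$-semimodules are e-injective. (3) $S\simeq R\oplus T$ as semirings, where $R$ is a semisimple ring and $T$ is a finite Boolean algebra.
   Context: A semiring is $(S,+,\cdot,0,1)$ with $(S,+,0)$ a commutative monoid, $(S,\cdot,1)$ a monoid, multiplication distributing over addition on both sides, and $0s=0=s0$ for all $s$ ($0=1$ is not excluded, so the one-element semiring is allowed as $R$ or $T$). A Boolean algebra is a semiring with join as addition and meet as multiplication. $R\oplus T$ is the direct product semiring with componentwise operations. A left $S$-semimodule is a commutative monoid $(M,+,0)$ with a scalar multiplication $S\times M\to M$ satisfying $(ss')m=s(s'm)$, $s(m+m')=sm+sm'$, $(s+s')m=sm+s'm$, $1m=m$, $s0=0=0m$. Homomorphisms preserve $+$, $0$ and scalar multiplication; ${}_S\mathcal{M}$ is the category of left $S$-semimodules and $\mathcal{M}$ the category of commutative monoids. A semimodule is cyclic (finitely generated) if it is a homomorphic image of ${}_SS$ (of $({}_SS)^n$ for some finite $n$). A subsemimodule $A$ of $M$ is subtractive if $m,m+m'\in A$ implies $m'\in A$ for all $m,m'\in M$. The semiring $S$ is left subtractive if every left ideal (subsemimodule of ${}_SS$) is subtractive. A sequence $0\to A\xrightarrow{f}B\xrightarrow{g}C\to 0$ in ${}_S\mathcal{M}$ (or in $\mathcal{M}$) is short exact if $f$ is a categorical kernel of $g$ and $g$ is a categorical cokernel of $f$ (kernels and cokernels in the sense of categories with zero morphisms). $M\in{}_S\mathcal{M}$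 is e-injective if the contravariant functor $\mathrm{Hom}_S(-,M):{}_S\mathcal{M}\to\mathcal{M}$ sends every short exact sequence $0\to A\to B\to C\to 0$ to a short exact sequence $0\to\mathrm{Hom}_S(C,M)\to\mathrm{Hom}_S(B,M)\to\mathrm{Hom}_S(A,M)\to 0$ in $\mathcal{M}$. *)

(* Defs.v *)
(* MathComp, with the classical axioms of mathcomp.classical.boolp. *)
From HB Require Import structures.
From mathcomp Require Import all_boot all_order all_algebra.
From mathcomp Require Import boolp classical_sets cardinality fsbigop.
Set Implicit Arguments.
Unset Strict Implicit.
Unset Printing Implicit Defensive.
Import Order.TTheory GRing.Theory.
Local Open Scope classical_set_scope.
Local Open Scope ring_scope.

(* Semirings are [pzSemiRingType]s (0 = 1 allowed), commutative monoids are
   [nmodType]s and left S-semimodules are [lSemiModType S]s. The choice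
   structure these carry is no restriction, by [boolp.gen_choiceMixin]. *)

Section Semimodules.
Variables (S : pzSemiRingType) (M : lSemiModType S).

Definition subsemimodule (A : set M) : Prop :=
  [/\ A 0, forall x y, A x -> A y -> A (x + y)
    & forall s x, A x -> A (s *: x)].

Definition subtractive (A : set M) : Prop :=
  forall m m' : M, A m -> A (m + m') -> A m'.

Definition cyclic_semimodule : Prop :=
  exists f : {linear S^o -> M}, forall y, exists x, f x = y.

Definition fg_semimodule : Prop :=
  exists n, exists f : {linear {ffun 'I_n -> S^o} -> M},
    forall y, exists x, f x = y.

Definition simple_subsemimodule (L : set M) : Prop :=
  [/\ subsemimodule L, L <> [set 0]
    & forall N : set M, subsemimodule N -> N `<=` L -> N = [set 0] \/ N = L].

(* M is the internal direct sum of a family of simple subsemimodules: every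
   element is in a unique way a finitely supported sum of members of the
   family. *)
Definition semisimple_semimodule : Prop :=
  exists (I : choiceType) (L : I -> set M),
    (forall i, simple_subsemimodule (L i)) /\
    (forall x : M, exists! y : I -> M,
       [/\ forall i, L i (y i), finite_set [set i | y i <> 0]
         & x = \sum_(i \in [set: I]) y i]).

End Semimodules.

Definition left_subtractive (S : pzSemiRingType) : Prop :=
  forall A : set S^o, subsemimodule A -> subtractive A.

(* Over a ring, subsemimodules of R^o are closed under x |-> - x = -1 *: x,
   hence are exactly the left ideals. *)
Definition semisimple_ring (R : pzRingType) : Prop :=
  semisimple_semimodule (R^o : lSemiModType R).

Section SemimoduleExactness.
Variables (S : pzSemiRingType) (A B C : lSemiModType S).
Implicit Types (f : {linear A -> B}) (g : {linear B -> C}).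

Definition is_kernel f g : Prop :=
  (forall a, g (f a) = 0) /\
  forall (D : lSemiModType S) (h : {linear D -> B}),
    (forall d, g (h d) = 0) ->
    exists! k : {linear D -> A}, forall d, f (k d) = h d.

Definition is_cokernel f g : Prop :=
  (forall a, g (f a) = 0) /\
  forall (D : lSemiModType S) (h : {linear B -> D}),
    (forall a, h (f a) = 0) ->
    exists! k : {linear C -> D}, forall b, k (g b) = h b.

Definition short_exact f g : Prop := is_kernel f g /\ is_cokernel f g.

End SemimoduleExactness.

Section MonoidExactness.
Variables (A B C : nmodType).
Implicit Types (f : {additive A -> B}) (g : {additive B -> C}).

Definition is_monoid_kernel f g : Prop :=
  (forall a, g (f a) = 0) /\
  forall (D : nmodType) (h : {additive D -> B}),
    (forall d, g (h d) = 0) ->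
    exists! k : {additive D -> A}, forall d, f (k d) = h d.

Definition is_monoid_cokernel f g : Prop :=
  (forall a, g (f a) = 0) /\
  forall (D : nmodType) (h : {additive B -> D}),
    (forall a, h (f a) = 0) ->
    exists! k : {additive C -> D}, forall b, k (g b) = h b.

Definition monoid_short_exact f g : Prop :=
  is_monoid_kernel f g /\ is_monoid_cokernel f g.

End MonoidExactness.

Section HomMonoid.
Variables (S : pzSemiRingType) (A M : lSemiModType S).

Definition HomS : Type := {linear A -> M}.

HB.instance Definition _ := gen_eqMixin HomS.
HB.instance Definition _ := gen_choiceMixin HomS.

Lemma HomS_ext (f g : {linear A -> M}) : f =1 g -> f = g.
Proof.
move=> /funext; case: f g => [f cf] [g cg] /= efg.
case: _ / efg cg => cg; congr GRing.Linear.Pack.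
case: cf cg => [[fa] [fs]] [[ga] [gs]].
by rewrite (Prop_irrelevance fa ga) (Prop_irrelevance fs gs).
Qed.

Definition HomS_zero : HomS := (\0 : A -> M).
Definition HomS_add (f g : HomS) : HomS := ((f : {linear A -> M}) \+ g : A -> M).

Lemma HomS_addA : associative HomS_add.
Proof. by move=> f g h; apply: HomS_ext => x /=; rewrite addrA. Qed.

Lemma HomS_addC : commutative HomS_add.
Proof. by move=> f g; apply: HomS_ext => x /=; rewrite addrC. Qed.

Lemma HomS_add0 : left_id HomS_zero HomS_add.
Proof. by move=> f; apply: HomS_ext => x /=; rewrite add0r. Qed.

HB.instance Definition _ := GRing.isNmodule.Build HomS
  HomS_addA HomS_addC HomS_add0.

End HomMonoid.

Section HomFunctor.
Variables (S : pzSemiRingType) (A B M : lSemiModType S) (f : {linear A -> B}).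

Definition HomS_map (h : HomS B M) : HomS A M :=
  ((h : {linear B -> M}) \o f : A -> M).

Lemma HomS_map_is_additive : nmod_morphism HomS_map.
Proof. by split=> [|h k]; apply: HomS_ext. Qed.

HB.instance Definition _ :=
  GRing.isNmodMorphism.Build (HomS B M) (HomS A M) HomS_map HomS_map_is_additive.

End HomFunctor.
Arguments HomS_map {S A B} M f h.

Definition e_injective (S : pzSemiRingType) (M : lSemiModType S) : Prop :=
  forall (A B C : lSemiModType S)
         (f : {linear A -> B}) (g : {linear B -> C}),
    short_exact f g ->
    monoid_short_exact (HomS_map M g : {additive HomS C M -> HomS B M})
                       (HomS_map M f : {additive HomS B M -> HomS A M}).

(* + is join, * is meet, 0 is bottom and 1 is top. *)
Section BooleanSemiring.
Variables (d : Order.disp_t) (T : ctbDistrLatticeType d).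

Definition boolean_semiring : Type := T.

HB.instance Definition _ := Choice.on boolean_semiring.

HB.instance Definition _ := GRing.isNmodule.Build boolean_semiring
  (@joinA d T) (@joinC d T)
  (@join0x d T).

HB.instance Definition _ :=
  GRing.Nmodule_isPzSemiRing.Build boolean_semiring
    (@meetA d T) (@meet1x d T)
    (@meetx1 d T) (@meetUl d T)
    (@meetUr d T) (@meet0x d T)
    (@meetx0 d T).

End BooleanSemiring.

Definition semiring_iso (S S' : pzSemiRingType) : Prop :=
  exists f : {rmorphism S -> S'}, bijective f.

(* Main.v *)
(** e-injectivity of M says that homomorphisms into M extend along subtractive
    inclusions A <= B, and that two homomorphisms agreeing on A become equal
    after adding homomorphisms that vanish on A.

    Let all cyclic semimodules be e-injective, and let V be the ideal of
    additively invertible elements of S. Extending S/V -> S/V to a semimodule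
    with an extra element absorbing all others yields t with s + t in t + V for
    all s. As S is von Neumann regular, this produces orthogonal central
    idempotents e + f = 1 with V = Sf. The semiring Sf is a ring all of whose
    cyclic modules are injective, and left subtractivity makes 1 the top element
    of Se, which is then a Boolean algebra. Finiteness of both follows Osofsky:
    an infinite sequence of orthogonal idempotents z_n would give a cyclic
    quotient (modulo "almost all z_n") that is not injective. Hence 1 is a finite
    orthogonal sum of idempotents generating simple left ideals.

    Conversely, over R x T a map on A <= B is extended on the ring part by a
    complement of A, and on the Boolean part by sending what lies outside A to
    the sum of the generators of M, which absorbs everything. *)
From HB Require Import structures.
From mathcomp Require Import all_boot all_order all_algebra.
From mathcomp Require Import boolp classical_sets cardinality fsbigop.
Require Import Defs.
Set Implicit Arguments.
Unset Strict Implicit.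
Unset Printing Implicit Defensive.
Import Order.Theory GRing.Theory Order.DefaultSetSubsetOrder.
Local Open Scope classical_set_scope.
Local Open Scope ring_scope.

(** * Subsemimodules, quotients and exact sequences *)

Lemma ex_linear (S : pzSemiRingType) (A B : lSemiModType S) (f : A -> B) :
  (forall x y, f (x + y) = f x + f y) -> (forall s x, f (s *: x) = s *: f x) ->
  exists F : {linear A -> B}, F =1 f.
Proof.
move=> fD fZ.
have f0 : f 0 = 0 by rewrite -(scale0r (0 : A)) fZ scale0r.
pose m1 := GRing.isNmodMorphism.Build A B f (conj f0 fD).
pose m2 := GRing.isScalable.Build S A B *:%R f fZ.
pose F : {linear A -> B} := HB.pack f m1 m2.
by exists F.
Qed.

Lemma ex_additive (A B : nmodType) (f : A -> B) :
  f 0 = 0 -> (forall x y, f (x + y) = f x + f y) ->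
  exists F : {additive A -> B}, F =1 f.
Proof.
move=> f0 fD.
pose m1 := GRing.isNmodMorphism.Build A B f (conj f0 fD).
pose F : {additive A -> B} := HB.pack f m1.
by exists F.
Qed.

Lemma additive_ext (A B : nmodType) (f g : {additive A -> B}) : f =1 g -> f = g.
Proof.
move=> /funext; case: f g => [f cf] [g cg] /= efg.
case: _ / efg cg => cg; congr GRing.Additive.Pack.
case: cf cg => [[fa]] [[ga]].
by rewrite (Prop_irrelevance fa ga).
Qed.

Lemma ex_submodule (S : pzSemiRingType) (M : lSemiModType S) (A : set M) :
  subsemimodule A -> exists (N : lSemiModType S) (i : {linear N -> M}),
    injective i /\ forall x, A x <-> exists y, i y = x.
Proof.
case=> A0 AD AZ; pose N := {x : M | `[< A x >]}.
have NP (x : N) : A (\val x) by exact/asboolP/(valP x).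
pose mk x (Ax : A x) : N := exist _ x (asboolT Ax).
pose add (x y : N) := mk _ (AD _ _ (NP x) (NP y)).
pose scale s (x : N) := mk _ (AZ s _ (NP x)).
have addA : associative add by move=> x y z; apply: val_inj; rewrite /= addrA.
have addC : commutative add by move=> x y; apply: val_inj; rewrite /= addrC.
have add0 : left_id (mk _ A0) add by move=> x; apply: val_inj; rewrite /= add0r.
pose m1 := GRing.isNmodule.Build N addA addC add0.
pose Nn : nmodType := HB.pack N m1.
pose sc : S -> Nn -> Nn := scale.
have sA a b v : sc a (sc b v) = sc (a * b) v.
  by apply: val_inj; rewrite /= scalerA.
have s0 v : sc 0 v = 0 by apply: val_inj; rewrite /= scale0r.
have s1 : left_id 1 sc.
  by move=> v; apply: val_inj; rewrite /= scale1r.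
have sDr : right_distributive sc +%R.
  by move=> a u v; apply: val_inj; rewrite /= scalerDr.
have sDl v : {morph sc^~ v : a b / a + b}.
  by move=> a b; apply: val_inj; rewrite /= scalerDl.
pose m2 := GRing.Nmodule_isLSemiModule.Build S Nn sA s0 s1 sDr sDl.
pose Nm : lSemiModType S := HB.pack N m1 m2.
have [|| i iE] := @ex_linear S Nm M (fun x : N => \val x) => //.
exists Nm, i; split=> [x y|x]; first by rewrite !iE => /val_inj.
split=> [Ax|[y <-]]; first by exists (mk x Ax); rewrite iE.
by rewrite iE; apply: NP.
Qed.

Record congruence (S : pzSemiRingType) (M : lSemiModType S)
    (E : M -> M -> Prop) : Prop := Congruence {
  cong_refl : forall x, E x x;
  cong_sym : forall x y, E x y -> E y x;
  cong_trans : forall x y z, E x y -> E y z -> E x z;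
  congD : forall x x' y y', E x x' -> E y y' -> E (x + y) (x' + y');
  congZ : forall s x y, E x y -> E (s *: x) (s *: y) }.

Lemma ex_quotient (S : pzSemiRingType) (M : lSemiModType S) (E : M -> M -> Prop) :
  congruence E -> exists (Q : lSemiModType S) (p : {linear M -> Q}),
    (forall y, exists x, p x = y) /\ forall x y, p x = p y <-> E x y.
Proof.
case=> Er Es Et ED EZ.
(* The carrier is the set of canonical representatives of the classes. *)
have exE x : exists y, `[< E x y >] by exists x; apply/asboolP.
pose can x := xchoose (exE x).
have canP x : E x (can x) by apply/asboolP/(xchooseP (exE x)).
have canE x y : E x y -> can x = can y.
  move=> Exy; apply: eq_xchoose => z; apply/asboolP/asboolP => [|]; last exact: Et.
  exact/Et/Es.
pose Q := {x : M | can x == x}.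
have mkP x : can (can x) == can x by apply/eqP/esym/canE.
pose mk x : Q := exist _ (can x) (mkP x).
have mkE x y : mk x = mk y <-> E x y.
  split=> [[exy]|Exy]; last by apply: val_inj; apply: canE.
  by apply: Et (canP x) _; rewrite exy; apply: Es.
have mkK (x : Q) : mk (\val x) = x by apply: val_inj => /=; exact/eqP/(valP x).
have valK x : E (\val (mk x)) x by exact/Es/canP.
pose add (x y : Q) := mk (\val x + \val y).
pose scale s (x : Q) := mk (s *: \val x).
have addE x y : add (mk x) (mk y) = mk (x + y) by apply/mkE/ED.
have scaleE s x : scale s (mk x) = mk (s *: x) by apply/mkE/EZ.
have addA : associative add.
  move=> x y z; rewrite -(mkK x) -(mkK y) -(mkK z) !addE.
  by rewrite addrA.
have addC : commutative add by move=> x y; rewrite /add addrC.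
have add0 : left_id (mk 0) add by move=> x; rewrite -(mkK x) addE add0r.
pose m1 := GRing.isNmodule.Build Q addA addC add0.
pose Qn : nmodType := HB.pack Q m1.
pose sc : S -> Qn -> Qn := scale.
have scE s x : sc s (mk x) = mk (s *: x) by apply: scaleE.
have plusE x y : (mk x : Qn) + (mk y : Qn) = mk (x + y) by apply: addE.
have sA a b v : sc a (sc b v) = sc (a * b) v.
  by rewrite -(mkK v) !scE scalerA.
have s0 v : sc 0 v = 0 by rewrite -(mkK v) scE scale0r.
have s1 : left_id 1 sc.
  by move=> v; rewrite -(mkK v) scE scale1r.
have sDr : right_distributive sc +%R.
  move=> a u v; rewrite -(mkK u) -(mkK v).
  by rewrite plusE !scE plusE scalerDr.
have sDl v : {morph sc^~ v : a b / a + b}.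
  by move=> a b; rewrite -(mkK v) !scE plusE scalerDl.
pose m2 := GRing.Nmodule_isLSemiModule.Build S Qn sA s0 s1 sDr sDl.
pose Qm : lSemiModType S := HB.pack Q m1 m2.
have [|| p pE] := @ex_linear S M Qm mk.
- by move=> x y; rewrite plusE.
- by move=> s x; rewrite -scE.
exists Qm, p; split=> [y|x y]; first by exists (\val y); rewrite pE mkK.
by rewrite !pE.
Qed.

Lemma factor_surj (S : pzSemiRingType) (A B C : lSemiModType S)
    (g : {linear A -> B}) (h : {linear A -> C}) :
  (forall y, exists x, g x = y) -> (forall x y, g x = g y -> h x = h y) ->
  exists k : {linear B -> C}, forall x, k (g x) = h x.
Proof.
move=> /choice[r rK] gh.
have hr x : h (r (g x)) = h x by apply: gh; rewrite rK.
have [||k kE] := @ex_linear _ _ _ (h \o r).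
- by move=> x y; rewrite /= -linearD; apply: gh; rewrite linearD !rK.
- by move=> s x; rewrite /= -linearZZ; apply: gh; rewrite linearZZ !rK.
by exists k => x; rewrite kE /= hr.
Qed.

Lemma factor_inj (S : pzSemiRingType) (A B C : lSemiModType S)
    (i : {linear A -> B}) (h : {linear C -> B}) :
  injective i -> (forall x, exists y, i y = h x) ->
  exists k : {linear C -> A}, forall x, i (k x) = h x.
Proof.
move=> inji /choice[k kK].
have [||k' kE] := @ex_linear _ _ _ k.
- by move=> x y; apply: inji; rewrite linearD !kK linearD.
- by move=> s x; apply: inji; rewrite linearZZ !kK linearZZ.
by exists k' => x; rewrite kE.
Qed.

(** The Bourne congruence of [A]: when [A] is a subsemimodule, the quotient by it is the cokernel of
    the inclusion of [A]. *)
Definition bourne (S : pzSemiRingType) (M : lSemiModType S) (A : set M) (x y : M) :=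
  exists a a', [/\ A a, A a' & x + a = y + a'].

Lemma bourne_congruence (S : pzSemiRingType) (M : lSemiModType S) (A : set M) :
  subsemimodule A -> congruence (bourne A).
Proof.
case=> A0 AD AZ; split.
- by move=> x; exists 0, 0.
- by move=> x y [a [b [Aa Ab E]]]; exists b, a.
- move=> x y z [a [b [Aa Ab E]]] [c [d [Ac Ad F]]]; exists (a + c), (b + d).
  by split; [exact: AD..|]; rewrite addrA E addrAC F -!addrA (addrC b).
- move=> x x' y y' [a [b [Aa Ab E]]] [c [d [Ac Ad F]]].
  by exists (a + c), (b + d); split; [exact: AD..|]; rewrite addrACA E F addrACA.
- move=> s x y [a [b [Aa Ab E]]]; exists (s *: a), (s *: b).
  by split; [exact: AZ..|]; rewrite -!scalerDr E.
Qed.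

Lemma range_subsemimodule (S : pzSemiRingType) (A B : lSemiModType S)
    (f : {linear A -> B}) : subsemimodule (range f).
Proof.
split; first by exists 0; rewrite ?linear0.
- by move=> _ _ [x _ <-] [y _ <-]; exists (x + y); rewrite ?linearD.
- by move=> s _ [x _ <-]; exists (s *: x); rewrite ?linearZZ.
Qed.

Lemma ex_scale (S : pzSemiRingType) (M : lSemiModType S) (x : M) :
  exists h : {linear S^o -> M}, forall s : S, h s = s *: x.
Proof.
have [||h hE] := @ex_linear S S^o M (fun s : S => s *: x).
- by move=> a b; rewrite scalerDl.
- by move=> a b; rewrite scalerA.
by exists h.
Qed.

Section Exactness.
Variables (S : pzSemiRingType) (A B C : lSemiModType S).
Variables (f : {linear A -> B}) (g : {linear B -> C}).

Lemma cokernelP : is_cokernel f g <->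
  (forall y, exists x, g x = y) /\
  (forall x y, g x = g y <-> bourne (range f) x y).
Proof.
have cR := bourne_congruence (range_subsemimodule f).
split=> [[gf cok]|[surj gE]]; last first.
  have gf a : g (f a) = 0.
    rewrite -(linear0 g); apply/gE; exists 0, (f a).
    by split; [exists 0; rewrite ?linear0|exists a|rewrite addr0 add0r].
  split=> // D h hf.
  have gh x y : g x = g y -> h x = h y.
    move=> /gE[_ [_ [[a _ <-] [b _ <-]]]] /(congr1 h).
    by rewrite !linearD !hf !addr0.
  have [k kE] := factor_surj surj gh.
  exists k; split=> // k' k'E; apply: HomS_ext => y.
  by have [x <-] := surj y; rewrite kE k'E.
split=> [y|x y].
  (* The corestriction [p] of [g] to its image kills the range of [f], so it factors through [g] as
     [k]. Both [i \o k] and the identity factor [g] through itself, so they agree and the image is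
     all of [C]. *)
  have [N [i [inji iE]]] := ex_submodule (range_subsemimodule g).
  have [x|p pE] := @factor_inj _ _ _ _ i g inji; first by apply/iE; exists x.
  have [a|k [kE _]] := cok _ p; first by apply: inji; rewrite pE gf linear0.
  have [k0 [_ k0U]] := cok _ g gf.
  have e1 : k0 = idfun :> {linear C -> C} by apply: k0U.
  have e2 : k0 = (i \o k : {linear C -> C}).
    by apply: k0U => b /=; rewrite kE pE.
  have <- : i (k y) = y.
    have /(congr1 (fun h : {linear C -> C} => h y)) := e2.
    by rewrite e1.
  by have [|z _ <-] := (iE (i (k y))).2; [by exists (k y)|exists z].
split=> [|[_ [_ [[a _ <-] [b _ <-]]]] /(congr1 g)]; last first.
  by rewrite !linearD !gf !addr0.
(* The quotient map modulo the Bourne congruence kills the range of [f] and hence factors through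
   [g], so elements identified by [g] are congruent. *)
have [Q [p [_ pE]]] := ex_quotient cR.
have [a|k [kE _]] := cok _ p.
  rewrite -(linear0 p); apply/pE; exists 0, (f a).
  by split; [exists 0; rewrite ?linear0|exists a|rewrite addr0 add0r].
by move=> /(congr1 k); rewrite !kE => /pE.
Qed.

(** Maps out of [S^o] represent elements. Testing the universal property on them gives the image of
    [f] by existence of the lift and injectivity by its uniqueness. *)
Lemma kernelP : is_kernel f g <->
  injective f /\ (forall x, g x = 0 <-> exists a, f a = x).
Proof.
split=> [[gf ker]|[inj gE]]; last first.
  split=> [a|D h gh]; first by apply/gE; exists a.
  have [x|k kE] := @factor_inj _ _ _ _ f h inj; first exact/gE/gh.
  by exists k; split=> // k' k'E; apply: HomS_ext => x; apply: inj; rewrite kE.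
split=> [a b ab|x]; last first.
  split=> [gx|[a <-]//]; have [h hE] := ex_scale x.
  have [s|k [kE _]] := ker _ h; first by rewrite hE linearZZ gx scaler0.
  by exists (k 1); rewrite kE hE scale1r.
have [h hE] := ex_scale (f a).
have [ha haE] := ex_scale a; have [hb hbE] := ex_scale b.
have [s|k [_ kU]] := ker _ h; first by rewrite hE linearZZ gf scaler0.
have ea : k = ha by apply: kU => s; rewrite hE haE linearZZ.
have eb : k = hb by apply: kU => s; rewrite hE hbE linearZZ ab.
by rewrite -(scale1r a) -haE -ea eb hbE scale1r.
Qed.

Lemma short_exactP : short_exact f g <->
  [/\ injective f, forall x, g x = 0 <-> exists a, f a = x,
      forall y, exists x, g x = y & forall x y, g x = g y <-> bourne (range f) x y].
Proof. by rewrite /short_exact kernelP cokernelP; split=> [[[]] ? ? []|[]]. Qed.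

End Exactness.

(* Cokernels of commutative monoids are handled as cokernels of nat-semimodules. *)
Definition nat_semimodule (N : nmodType) : Type := N.

Section NatSemimodule.
Variable N : nmodType.
HB.instance Definition _ := GRing.Nmodule.on (nat_semimodule N).

Definition nat_scale (n : nat) (x : nat_semimodule N) : nat_semimodule N := x *+ n.

Lemma nat_scalerA m n x : nat_scale m (nat_scale n x) = nat_scale (m * n) x.
Proof. by rewrite /nat_scale -mulrnA mulnC. Qed.
Lemma nat_scale0r x : nat_scale 0 x = 0. Proof. by []. Qed.
Lemma nat_scale1r : left_id 1 nat_scale. Proof. by []. Qed.
Lemma nat_scalerDr : right_distributive nat_scale +%R.
Proof. by move=> n x y; rewrite /nat_scale mulrnDl. Qed.
Lemma nat_scalerDl x : {morph nat_scale^~ x : m n / m + n}.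
Proof. by move=> m n; rewrite /nat_scale mulrnDr. Qed.

HB.instance Definition _ := GRing.Nmodule_isLSemiModule.Build nat
  (nat_semimodule N) nat_scalerA nat_scale0r nat_scale1r nat_scalerDr nat_scalerDl.

End NatSemimodule.

Lemma nat_scaleE (D : lSemiModType nat) (n : nat) (x : D) : n *: x = x *+ n.
Proof. by rewrite -[n in LHS]natn scaler_nat. Qed.

Lemma monoid_cokernelP (A B C : nmodType) (f : {additive A -> B})
    (g : {additive B -> C}) : is_monoid_cokernel f g ->
  (forall y, exists x, g x = y) /\
  forall x y, g x = g y -> exists a a', x + f a = y + f a'.
Proof.
case=> gf cok.
have lin (X Y : nmodType) (u : {additive X -> Y}) :
    exists v : {linear nat_semimodule X -> nat_semimodule Y}, v =1 u.
  by apply: ex_linear => [x y|n x]; rewrite ?raddfD // !nat_scaleE raddfMn.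
have [f' f'E] := lin _ _ f; have [g' g'E] := lin _ _ g.
have /cokernelP[surj gE] : is_cokernel f' g'.
  split=> [a|D h hf]; first by rewrite g'E f'E gf.
  have [||h' h'E] := @ex_additive B D h.
  - exact: (linear0 h).
  - exact: (linearD h).
  have [a|k [kE kU]] := cok D h'; first by rewrite h'E -f'E hf.
  have [||k' k'E] := @ex_linear nat (nat_semimodule C) D k.
  - exact: raddfD.
  - by move=> n x; rewrite !nat_scaleE raddfMn.
  exists k'; split=> [b|l lE]; first by rewrite k'E g'E kE h'E.
  have [||l' l'E] := @ex_additive C D l.
  - exact: (linear0 l).
  - exact: (linearD l).
  have kl : k = l' by apply: kU => b; rewrite l'E -g'E lE h'E.
  by apply: HomS_ext => y; rewrite k'E kl l'E.
split=> [y|x y exy]; first by have [x <-] := surj y; exists x; rewrite g'E.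
have /gE[_ [_ [[a _ <-] [b _ <-] e]]] : g' x = g' y by rewrite !g'E.
by exists a, b; rewrite -!f'E.
Qed.

(** * e-injectivity as extending and equating homomorphisms *)

(** A homomorphism on [A] is encoded as a total function whose values off [A] are arbitrary. *)
Definition linear_on (S : pzSemiRingType) (B M : lSemiModType S) (A : set B)
    (h : B -> M) :=
  (forall x y, A x -> A y -> h (x + y) = h x + h y) /\
  (forall s x, A x -> h (s *: x) = s *: h x).

Definition extends_linear_maps (S : pzSemiRingType) (M : lSemiModType S) :=
  forall (B : lSemiModType S) (A : set B) (h : B -> M),
    subsemimodule A -> subtractive A -> linear_on A h ->
    exists H : {linear B -> M}, forall x, A x -> H x = h x.

Definition equates_extensions (S : pzSemiRingType) (M : lSemiModType S) :=
  forall (B : lSemiModType S) (A : set B) (h h' : {linear B -> M}),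
    subsemimodule A -> subtractive A -> (forall x, A x -> h x = h' x) ->
    exists k k' : {linear B -> M},
      [/\ forall x, A x -> k x = 0, forall x, A x -> k' x = 0
        & forall x, h x + k x = h' x + k' x].

(** The kernel half of exactness of the Hom sequence always holds. By [monoid_cokernelP] the
    cokernel half means that restriction to [A] is onto and that maps with equal restrictions agree
    after adding maps that factor through [C]. *)
Lemma e_injectiveP (S : pzSemiRingType) (M : lSemiModType S) :
  e_injective M <-> extends_linear_maps M /\ equates_extensions M.
Proof.
split=> [eM|[ext eqs] A B C f g].
  suff hM (B : lSemiModType S) (A : set B) : subsemimodule A -> subtractive A ->
      exists (N C : lSemiModType S) (i : {linear N -> B}) (p : {linear B -> C}),
      [/\ injective i, range i = A, forall x, A x -> p x = 0 &
        (forall h : HomS N M, exists H, HomS_map M i H = h) /\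
        (forall h h' : HomS B M, HomS_map M i h = HomS_map M i h' ->
          exists k k', h + HomS_map M p k = h' + HomS_map M p k')].
    split=> [B A h sA tA [hD hZ]|B A h h' sA tA hh'].
      have [N [_ [i [_ [inji iE _ [surj _]]]]]] := hM B A sA tA.
      have Ai x : A (i x) by rewrite -iE; exists x.
      have [||u uE] := @ex_linear S N M (h \o i).
      - by move=> x y; rewrite /= linearD hD.
      - by move=> s x; rewrite /= linearZZ hZ.
      have [H HE] := surj u; exists H => x.
      rewrite -iE => -[y _ <-].
      have /(congr1 (fun v : {linear N -> M} => v y)) := HE.
      by rewrite uE.
    have [N [C [i [p [inji iE pA [_ inj]]]]]] := hM B A sA tA.
    have [|k [k' kk']] := inj h h'.
      by apply: HomS_ext => x /=; apply: hh'; rewrite -iE; exists x.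
    exists (HomS_map M p k), (HomS_map M p k'); split=> [x Ax|x Ax|x].
    - by rewrite /= pA // linear0.
    - by rewrite /= pA // linear0.
    by have /(congr1 (fun v : {linear B -> M} => v x)) := kk'.
  move=> sA tA.
  have [N [i [inji iE]]] := ex_submodule sA.
  have rE : range i = A.
    by apply/seteqP; split=> [x [y _ yx]|x /iE[y yx]]; [apply/iE; exists y|exists y].
  have [C [p [surjp pE]]] := ex_quotient (bourne_congruence sA).
  have [A0 AD AZ] := sA.
  (* Subtractivity makes the zero class of the Bourne congruence equal to [A], so [A] is the kernel
     of its quotient map. *)
  have pA x : p x = 0 <-> A x.
    rewrite -(linear0 p) pE; split=> [[a [b [Aa Ab]]]|Ax].
      by rewrite add0r addrC => e; apply: (tA a x Aa); rewrite e.
    by exists 0, x; rewrite addr0 add0r.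
  have sip : short_exact i p.
    apply/short_exactP; rewrite rE; split=> // x; rewrite pA; exact: iE.
  have [_ /monoid_cokernelP[surj eqs]] := eM _ _ _ _ _ sip.
  by exists N, C, i, p; split=> // x Ax; apply/pA.
move=> /short_exactP[inj fE surj gE].
have gf a : g (f a) = 0 by apply/fE; exists a.
have sA := range_subsemimodule f.
have tA : subtractive (range f).
  move=> _ m [a _ <-] [b _ /esym/(congr1 g)].
  by rewrite linearD !gf add0r => /fE[c <-]; exists c.
split; (split=> [k|D h hk]).
- by apply: HomS_ext => a /=; rewrite gf linear0.
- have hE d : exists k : HomS C M, HomS_map M g k = h d.
    have [x y /gE[_ [_ [[a _ <-] [b _ <-]]]]|k kE] := @factor_surj _ _ _ _ g (h d) surj.
      have hf c : (h d : {linear B -> M}) (f c) = 0.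
        by have /(congr1 (fun v : {linear A -> M} => v c)) := hk d.
      by move=> /(congr1 (h d : {linear B -> M})); rewrite !linearD !hf !addr0.
    by exists k; apply: HomS_ext => b /=; rewrite kE.
  have inj_g (k k' : HomS C M) : HomS_map M g k = HomS_map M g k' -> k = k'.
    move=> kk'; apply: HomS_ext => y; have [x <-] := surj y.
    by have /(congr1 (fun v : {linear B -> M} => v x)) := kk'.
  have [k kE] := choice hE.
  have [||k' k'E] := @ex_additive D (HomS C M) k.
  - by apply: inj_g; rewrite kE !raddf0.
  - by move=> x y; apply: inj_g; rewrite kE raddfD -!kE; exact/esym/raddfD.
  exists k'; split=> [d|l lE]; first by rewrite k'E; apply: kE.
  apply: additive_ext => d; apply: inj_g; rewrite k'E kE; exact/esym/lE.
- by apply: HomS_ext => a /=; rewrite gf linear0.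
have hE (u : HomS A M) : exists H : HomS B M, HomS_map M f H = u.
  have [r rE] : exists r : B -> A, forall a, r (f a) = a.
    have /choice[r rE] : forall b, exists a, range f b -> f a = b.
      move=> b; have [[a _ <-]|nb] := pselect (range f b); first by exists a.
      by exists 0.
    by exists r => a; apply: inj; apply: rE; exists a.
  have [|H HE] := ext B (range f) ((u : {linear A -> M}) \o r) sA tA.
    split=> [_ _ [a _ <-] [b _ <-]|s _ [a _ <-]] /=.
      by rewrite -linearD !rE linearD.
    by rewrite -linearZZ !rE linearZZ.
  by exists H; apply: HomS_ext => a /=; rewrite HE /= ?rE //; exists a.
(* Two maps with the same restriction agree after adding maps that factor through [g], and [h] kills
   those; so [h] depends on the restriction only. *)
have hU (u v : HomS B M) : HomS_map M f u = HomS_map M f v -> h u = h v.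
  move=> uv; have [|k [k' [kA k'A kk']]] := eqs B (range f) u v sA tA.
    move=> _ [a _ <-].
    by have /(congr1 (fun w : {linear A -> M} => w a)) := uv.
  have fac (w : {linear B -> M}) : (forall x, range f x -> w x = 0) ->
      exists t : HomS C M, HomS_map M g t = w.
    move=> wA.
    have [x y /gE[a [b [Ra Rb /(congr1 w)]]]|t tE] := @factor_surj _ _ _ _ g w surj.
      by rewrite !linearD (wA _ Ra) (wA _ Rb) !addr0.
    by exists t; apply: HomS_ext => b /=; rewrite tE.
  have [t tE] := fac k kA; have [t' t'E] := fac k' k'A.
  have e : u + HomS_map M g t = v + HomS_map M g t'.
    by rewrite tE t'E; apply: HomS_ext => x; apply: kk'.
  by have := congr1 h e; rewrite !raddfD !hk !addr0.
have [k kE] := choice hE.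
have [||k' k'E] := @ex_additive (HomS A M) D (h \o k).
- by rewrite /= -(raddf0 h); apply: hU; rewrite kE raddf0.
- move=> u v; rewrite /= -raddfD; apply: hU.
  rewrite kE -{1}(kE u) -{1}(kE v); exact/esym/raddfD.
exists k'; split=> [b|l lE]; first by rewrite k'E /=; apply: hU; apply: kE.
by apply: additive_ext => u; rewrite k'E /= -lE; congr (l _); apply: kE.
Qed.

(** * Baer's criterion for cyclic semimodules *)

(** By Zorn's lemma; [C] is the best candidate for a complement of [A] inside [D]. *)
Lemma max_disjoint_submodule (S : pzSemiRingType) (M : lSemiModType S) (D A : set M) :
  subsemimodule D -> A 0 ->
  exists C : set M, [/\ subsemimodule C, C `<=` D, forall x, C x -> A x -> x = 0 &
    forall C' : set M, subsemimodule C' -> C `<=` C' -> C' `<=` D ->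
      (forall x, C' x -> A x -> x = 0) -> C' `<=` C].
Proof.
move=> [D0 DD DZ] A0.
(* The empty set is admitted only to bound the empty chain. *)
pose P (C : set M) := C = set0 \/
  [/\ subsemimodule C, C `<=` D & forall x, C x -> A x -> x = 0].
have [F FP tF|C [PC Cmax]] := @Zorn_bigcup M P.
  have [[X FX [x Xx]]|nF] := pselect (exists2 X, F X & X !=set0); last first.
    left; apply/seteqP; split=> // x [X FX Xx].
    by case: nF; exists X => //; exists x.
  have FS Y y : F Y -> Y y ->
      [/\ subsemimodule Y, Y `<=` D & forall x, Y x -> A x -> x = 0].
    by move=> /FP[-> //|].
  right; split=> [|y [Y FY Yy]|y [Y FY Yy]].
  - have [[X0 _ _] _ _] := FS _ _ FX Xx; split; first by exists X.
      move=> y z [Y FY Yy] [Z FZ Zz].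
      have [YZ|ZY] := tF _ _ FY FZ.
        by exists Z => //; have [[_ ZD _] _ _] := FS _ _ FZ Zz; apply/ZD/Zz/YZ.
      by exists Y => //; have [[_ YD _] _ _] := FS _ _ FY Yy; apply/YD/ZY.
    move=> s y [Y FY Yy]; exists Y => //.
    by have [[_ _ YZ] _ _] := FS _ _ FY Yy; apply: YZ.
  - by have [_ YD _] := FS _ _ FY Yy; apply: YD.
  - by have [_ _ YA] := FS _ _ FY Yy; apply: YA.
have s0 : subsemimodule [set 0 : M].
  by split=> [|_ _ -> ->|s _ ->] //=; rewrite ?addr0 ?scaler0.
case: PC => [C0|[sC CD CA]].
  exfalso; apply: (Cmax [set 0]); last first.
    by right; split=> // _ ->.
  by rewrite C0; split=> // /(_ 0 erefl).
exists C; split=> // C' sC' CC' C'D C'A.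
apply: contrapT => nC'C; apply: (Cmax C'); first by split.
by right.
Qed.

(* Baer's criterion for all cyclic semimodules S/E at once: a partial
   homomorphism from a left ideal of S to S/E, given by a relation G on
   representatives, is right multiplication by some element. *)
Definition cyclic_baer (S : pzSemiRingType) :=
  forall (E : S^o -> S^o -> Prop) (G : S -> S -> Prop),
    congruence E -> G 0 0 ->
    (forall r m r' m', G r m -> G r' m' -> G (r + r') (m + m')) ->
    (forall s r m, G r m -> G (s * r) (s * m)) ->
    (forall r m m', G r m -> G r m' -> E m m') ->
    exists u, forall r m, G r m -> E m (r * u).

Lemma cyclic_self (S : pzSemiRingType) : cyclic_semimodule (S^o : lSemiModType S).
Proof. by exists (idfun : {linear S^o -> S^o}) => y; exists y. Qed.

Section CyclicEInjective.
Variables (S : pzSemiRingType) (hS : left_subtractive S).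
Hypothesis cyc : forall M : lSemiModType S, cyclic_semimodule M -> e_injective M.

(** Left subtractivity makes the domain of [G] subtractive, so the map that [G] defines into S/E
    extends to [S^o]; [u] represents the image of 1. *)
Lemma cyclic_e_injective_baer : cyclic_baer S.
Proof.
move=> E G cE G0 GD GZ GE.
have [Q [p [surj pE]]] := ex_quotient cE.
have /e_injectiveP[ext _] : e_injective Q by apply: cyc; exists p.
pose A : set S^o := [set r | exists m, G r m].
have sA : subsemimodule A.
  split; first by exists 0.
    by move=> x y [m Gm] [n Gn]; exists (m + n); apply: GD.
  by move=> s x [m Gm]; exists (s * m); apply: GZ.
have /choice[h hE] : forall r, exists m, A r -> G r m.
  by move=> r; have [[m Gm]|nA] := pselect (A r); [exists m|exists 0].
have [|H HE] := ext S^o A (p \o h) sA (hS sA).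
  split=> [x y Ax Ay|s x Ax] /=.
    rewrite -linearD; apply/pE/(GE (x + y)); first by apply/hE; case: sA => _ + _; exact.
    by apply: GD; apply: hE.
  rewrite -linearZZ; apply/pE/(GE (s * x)); first by apply/hE; case: sA => _ _; exact.
  by apply: GZ; apply: hE.
have [u uE] := surj (H 1); exists u => r m Grm.
have Ar : A r by exists m.
apply: (cong_trans cE) (GE _ _ _ Grm (hE _ Ar)) _; apply/pE.
have -> : p (h r) = H r by rewrite HE.
have {1}-> : r = (r : S) *: (1 : S^o) by rewrite /GRing.scale /= mulr1.
by rewrite linearZZ -uE -linearZZ.
Qed.

(** The maps s -> s x and s -> s y agree on the left ideal S e because e x = e y. The two maps that
    equate them vanish on S e, and [k], [k'] are their values at 1. *)
Lemma idempotent_equates (e x y : S) : e * e = e -> e * x = e * y ->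
  exists k k', [/\ e * k = 0, e * k' = 0 & x + k = y + k'].
Proof.
move=> ee exy.
have /e_injectiveP[_ eqs] := cyc (cyclic_self S).
pose A : set S^o := [set r : S | r * e = r].
have sA : subsemimodule A.
  split=> [|a b ae be|s a ae].
  - exact: mul0r.
  - by rewrite /A /= mulrDl ae be.
  - by rewrite /A /= -mulrA ae.
have [h hE] := @ex_scale S S^o x; have [h' h'E] := @ex_scale S S^o y.
have [|k [k' [kA k'A kk']]] := eqs S^o A h h' sA (hS sA).
  move=> a Aa; rewrite hE h'E /GRing.scale /=.
  by rewrite -[a]Aa -!mulrA exy.
have val (l : {linear S^o -> S^o}) (s : S) : l s = s * l 1.
  have {1}-> : s = (s : S) *: (1 : S^o) by rewrite /GRing.scale /= mulr1.
  by rewrite linearZZ.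
exists (k 1), (k' 1); split.
- by rewrite -val; apply: kA.
- by rewrite -val; apply: k'A.
- by have := kk' 1; rewrite hE h'E !scale1r.
Qed.

End CyclicEInjective.

Lemma cyclic_baer_surj (S S' : pzSemiRingType) (f : {rmorphism S -> S'}) :
  (forall y, exists x, f x = y) -> cyclic_baer S -> cyclic_baer S'.
Proof.
move=> surj baer E G [Er Es Et ED EZ] G0 GD GZ GE.
have [||r m r' m'|s r m|r m m'|u uE] :=
    baer (fun x y => E (f x) (f y)) (fun x y => G (f x) (f y)).
- split=> [x|x y|x y z|x x' y y'|s x y].
  + exact: Er.
  + exact: Es.
  + exact: Et.
  + by rewrite !rmorphD; apply: ED.
  + by rewrite /GRing.scale /= !rmorphM; apply: EZ.
- by rewrite rmorph0.
- by rewrite !rmorphD; apply: GD.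
- by rewrite !rmorphM; apply: GZ.
- exact: GE.
exists (f u) => r m; have [x <-] := surj r; have [y <-] := surj m.
by move=> /uE; rewrite rmorphM.
Qed.

Lemma eq_congruence (S : pzSemiRingType) (M : lSemiModType S) :
  congruence (@eq M).
Proof. by split=> // [x y z -> //|x x' y y' -> -> //|s x y ->]. Qed.

(** With a ~ b when a x = b x, the map S x -> S/~ sending m x to the class of m is well defined. If
    it is right multiplication by u, its value at x gives 1 ~ x u, that is x = x u x. *)
Lemma cyclic_baer_regular (S : pzSemiRingType) :
  cyclic_baer S -> forall x : S, exists u, x * u * x = x.
Proof.
move=> baer x.
have [||||r m m' -> //|u uE] :=
    baer (fun a b => a * x = b * x) (fun a b => a = b * x).
- split=> // [a b c -> //|a a' b b' aa' bb'|s a b ab].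
    by rewrite !mulrDl aa' bb'.
  by rewrite /GRing.scale /= -!mulrA ab.
- by rewrite mul0r.
- by move=> r m r' m' -> ->; rewrite mulrDl.
- by move=> s r m ->; rewrite mulrA.
by exists u; have := uE x 1; rewrite !mul1r => /(_ erefl).
Qed.

(** * Splitting off the additively invertible elements *)

Definition invertible (S : pzSemiRingType) : set S := [set x | exists y, x + y = 0].

Section Invertible.
Variable S : pzSemiRingType.
Local Notation V := (@invertible S).

Lemma invertible0 : V 0. Proof. by exists 0; rewrite addr0. Qed.

Lemma invertibleD x y : V x -> V y -> V (x + y).
Proof. by move=> [a xa] [b yb]; exists (a + b); rewrite addrACA xa yb addr0. Qed.

Lemma invertibleMl s x : V x -> V (s * x).
Proof. by move=> [a xa]; exists (s * a); rewrite -mulrDr xa mulr0. Qed.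

Lemma invertibleMr s x : V x -> V (x * s).
Proof. by move=> [a xa]; exists (a * s); rewrite -mulrDl xa mul0r. Qed.

Lemma invertible_addl x y : V (x + y) -> V x.
Proof. by move=> [z e]; exists (y + z); rewrite addrA. Qed.

Lemma invertible_cancel x y z : V x -> y + x = z + x -> y = z.
Proof.
move=> [a xa] e; have := congr1 (+%R^~ a) e.
by rewrite -!addrA xa !addr0.
Qed.

Lemma invertible_sub : subsemimodule (V : set S^o).
Proof.
by split; [exact: invertible0|exact: invertibleD|exact: invertibleMl].
Qed.

End Invertible.

Section Splitting.
Variables (S : pzSemiRingType) (hS : left_subtractive S).
Hypothesis cyc : forall M : lSemiModType S, cyclic_semimodule M -> e_injective M.
Local Notation V := (@invertible S).

(* Extend the identity of S/V to the semimodule generated by S/V and an element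
   w, of annihilator V, subject to s + w = w for all s; then t is the image of w. *)
Lemma absorbing_element :
  exists t : S, forall s, exists w, V w /\ s + t = t + w.
Proof.
have [Q [q [surjq qE]]] := ex_quotient (bourne_congruence (invertible_sub S)).
have /e_injectiveP[ext _] : e_injective Q by apply: cyc; exists q.
(* A pair (a, b) stands for a + b w, and [U y] consists of the u that y w absorbs. Quantifying over
   r keeps absorption stable under scalars: when r y falls into V, so must r u. Thus [U 0] is V,
   which embeds S/V, and [U 1] is all of S. *)
pose U (y u : S) := forall r, V (r * y) -> V (r * u).
have U0 y : U y 0 by move=> r _; rewrite mulr0; apply: invertible0.
have UD y u v : U y u -> U y v -> U y (u + v).
  by move=> Uu Uv r Vr; rewrite mulrDr; apply: invertibleD; [exact: Uu|exact: Uv].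
have UDl y y' u : U y u -> U (y + y') u.
  by move=> Uu r; rewrite mulrDr => /invertible_addl; apply: Uu.
have UZ s y u : U y u -> U (s * y) (s * u).
  by move=> Uu r; rewrite !mulrA; apply: Uu.
pose E (a b : S^o * S^o) := a.2 = b.2 /\
  exists u u', [/\ U a.2 u, U a.2 u' & a.1 + u = b.1 + u'].
have cE : congruence E.
  split.
  - by move=> a; split=> //; exists 0, 0.
  - by move=> a b [e [u [v [Uu Uv f]]]]; split=> //; exists v, u; rewrite -e.
  - move=> a b c [e [u [v [Uu Uv f]]]] [e' [x [y [Ux Uy f']]]].
    split; first by rewrite e.
    exists (u + x), (v + y); rewrite -e in Ux Uy.
    by split; [exact: UD..|]; rewrite addrA f addrAC f' -!addrA (addrC v).
  - move=> a b c d [e [u [v [Uu Uv f]]]] [e' [x [y [Ux Uy f']]]].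
    split; first by rewrite /= e e'.
    exists (u + x), (v + y); split; last by rewrite /= addrACA f f' addrACA.
      by apply: UD; [exact: UDl|rewrite /= addrC; exact: UDl].
    by apply: UD; [exact: UDl|rewrite /= addrC; exact: UDl].
  - move=> s a b [e [u [v [Uu Uv f]]]]; split; first by rewrite /= e.
    exists (s * u), (s * v); split; [exact: UZ|exact: UZ|].
    by rewrite /= /GRing.scale /= -!mulrDr f.
have [B [p [surjp pE]]] := ex_quotient cE.
have padd x y : p (x, 0) + p (y, 0) = p (x + y, 0).
  by rewrite -linearD; congr (p _); apply: injective_projections; rewrite /= ?addr0.
have pscale s x : s *: p (x, 0) = p (s *: x, 0).
  by rewrite -linearZZ; congr (p _); apply: injective_projections; rewrite /= ?scaler0.
pose A : set B := [set b | exists x, p (x, 0) = b].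
have sA : subsemimodule A.
  split; first by exists 0; apply: (linear0 p).
    by move=> _ _ [x <-] [y <-]; exists (x + y); apply/esym/padd.
  by move=> s _ [x <-]; exists (s *: x); apply/esym/pscale.
have tA : subtractive A.
  move=> _ m [x <-] [y]; have [[a b] <-] := surjp m.
  rewrite -linearD => /pE[/= + _]; rewrite add0r => <-.
  by exists a.
have /choice[h hE] : forall b, exists x, A b -> p (x, 0) = b.
  by move=> b; have [[x xb]|nA] := pselect (A b); [exists x|exists 0].
have qp x y : p (x, 0) = p (y, 0) -> q x = q y.
  move=> /pE[_ [u [v [/= Uu Uv f]]]]; apply/qE; exists u, v.
  by split=> //; [have := Uu 1|have := Uv 1]; rewrite !mul1r; apply; apply: invertible0.
have qh x : q (h (p (x, 0))) = q x by apply: qp; apply: hE; exists x.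
have [|H HE] := ext B A (q \o h) sA tA.
  split=> [_ _ [x <-] [y <-]|s _ [x <-]] /=.
    by rewrite padd !qh linearD.
  by rewrite pscale !qh linearZZ.
have [t tE] := surjq (H (p (0, 1))); exists t => s.
have : p (s, 0) + p (0, 1) = p (0, 1).
  rewrite -linearD; apply/pE; split; first exact: add0r.
  have e01 : ((s, 0) + (0, 1) : S^o * S^o).2 = 1 by apply: add0r.
  exists 0, s; rewrite e01; split=> //; last by rewrite addr0 addrC.
  by move=> r; rewrite mulr1; apply: invertibleMr.
move=> /(congr1 H); rewrite linearD -tE HE; last by exists s.
rewrite /= qh -linearD => /qE[a [b [[a' Va] Vb e]]].
exists (b + a'); split; first by apply: invertibleD => //; exists a; rewrite addrC.
by rewrite addrA -e -!addrA Va addr0.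
Qed.

Lemma splitting : exists e f t : S,
  [/\ V f, e + f = 1, e * e = e /\ f * f = f, e * f = 0 /\ f * e = 0 &
   [/\ forall x, e * x = x * e, forall x, f * x = x * f,
     e * t = t & forall x, e * x + t = t]].
Proof.
have baer := cyclic_e_injective_baer hS cyc.
have [t tE] := absorbing_element.
have [w [[s ws] e1]] := tE 1.
(* Here [s] is the additive inverse of the error [w], so [t] absorbs [tau] exactly. *)
pose tau := 1 + s.
have taut : tau + t = t by rewrite /tau -addrA (addrC s) addrA e1 -addrA ws addr0.
have Vs : V s by exists w; rewrite addrC.
have [v vE] := cyclic_baer_regular baer tau.
(* This idempotent generates the left ideal of [tau]. Hence what [e] kills on the left is killed by
   1 + s and has an additive inverse. *)
pose e := v * tau.
have ee : e * e = e by rewrite /e -mulrA (mulrA tau) vE.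
have taue : tau * e = tau by rewrite /e mulrA vE.
have [k [k' [ek ek' kE]]] : exists k k', [/\ e * k = 0, e * k' = 0 & 1 + k = e + k'].
  by apply: idempotent_equates => //; rewrite mulr1 ee.
have tk x : e * x = 0 -> x + s * x = 0.
  by move=> ex; rewrite -{1}[x]mul1r -mulrDl -/tau -taue -mulrA ex mulr0.
(* Since k + s k = 0, this is k' - k, and 1 + k = e + k' becomes 1 = e + f. *)
pose f := k' + s * k.
have Vf : V f by apply: invertibleD; [exists (s * k'); exact: tk|exact: invertibleMr].
have ef1 : e + f = 1 by rewrite /f addrA -kE -addrA tk // addr0.
have ef : e * f = 0.
  rewrite /f mulrDr ek' add0r.
  have := congr1 ( *%R e) (tk k ek); by rewrite mulrDr ek add0r mulr0.
have ff : f * f = f by have := congr1 ( *%R^~ f) ef1; rewrite mulrDl ef add0r mul1r.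
(* As e + y = y, multiplying by x in V gives x e + x y = x y, where x y is invertible and cancels.
   So V is annihilated by [e] on both sides. *)
pose y := v * t.
have ey : e + y = y by rewrite /e /y -mulrDr taut.
have Ve x : V x -> x * e = 0.
  move=> Vx; apply: (@invertible_cancel _ (x * y)); first exact: invertibleMr.
  by rewrite -mulrDr ey add0r.
have eV x : V x -> e * x = 0.
  move=> Vx; apply: (@invertible_cancel _ (y * x)); first exact: invertibleMl.
  by rewrite -mulrDl ey add0r.
have fe : f * e = 0 by apply: Ve.
have dec x : x = x * e + x * f by rewrite -mulrDr ef1 mulr1.
have decl x : x = e * x + f * x by rewrite -mulrDl ef1 mul1r.
(* Both x f and f x lie in V, which [e] kills, so e x = e x e = x e. *)
have ce x : e * x = x * e.
  rewrite [in LHS](dec x) [in RHS](decl x) mulrDr (mulrDl (e * x)).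
  rewrite (eV (x * f)); last exact: invertibleMl.
  rewrite (Ve (f * x)); last exact: invertibleMr.
  by rewrite mulrA.
have cf x : f * x = x * f.
  rewrite [in LHS](dec x) [in RHS](decl x) mulrDr (mulrDl (e * x)).
  rewrite [f * (x * e)]mulrA (Ve (f * x)); last exact: invertibleMr.
  rewrite -[e * x * f]mulrA (eV (x * f)); last exact: invertibleMl.
  by rewrite mulrA.
exists e, f, (e * t); split=> //; split=> // [|x].
  by rewrite mulrA ee.
have [z [Vz xz]] := tE x.
by rewrite -mulrDr xz mulrDr (eV z) // addr0.
Qed.

End Splitting.

(** * Corners of central idempotents *)

Lemma ex_rmorphism (S T : pzSemiRingType) (f : S -> T) :
  f 0 = 0 -> f 1 = 1 -> (forall x y, f (x + y) = f x + f y) ->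
  (forall x y, f (x * y) = f x * f y) -> exists F : {rmorphism S -> T}, F =1 f.
Proof.
move=> f0 f1 fD fM.
pose m1 := GRing.isNmodMorphism.Build S T f (conj f0 fD).
pose m2 := GRing.isMonoidMorphism.Build S T f (conj f1 fM).
pose F : {rmorphism S -> T} := HB.pack f m1 m2.
by exists F.
Qed.

(** The inclusion [i] sends 1 to [e], so it is kept as a plain function. *)
Lemma ex_corner (S : pzSemiRingType) (e : S) :
  e * e = e -> (forall x, e * x = x * e) ->
  exists (T : pzSemiRingType) (p : {rmorphism S -> T}) (i : T -> S),
    (forall x, i (p x) = e * x) /\ (forall y, p (i y) = y).
Proof.
move=> ee ce; pose T := {x : S | e * x == x}.
have eT (x : T) : e * \val x = \val x by apply/eqP/(valP x).
have mkP x : e * (e * x) == e * x by rewrite mulrA ee.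
pose mk x : T := exist _ (e * x) (mkP x).
have mkK (x : T) : mk (\val x) = x by apply: val_inj; rewrite /= eT.
pose add (x y : T) := mk (\val x + \val y).
pose mul (x y : T) := mk (\val x * \val y).
have addE x y : add (mk x) (mk y) = mk (x + y).
  by apply: val_inj; rewrite /= -mulrDr mulrA ee.
have mulE x y : mul (mk x) (mk y) = mk (x * y).
  by apply: val_inj; rewrite /= !mulrA ee -[e * x * e]mulrA -ce !mulrA ee.
have addA : associative add.
  by move=> x y z; rewrite -(mkK x) -(mkK y) -(mkK z) !addE addrA.
have addC : commutative add by move=> x y; rewrite /add addrC.
have add0 : left_id (mk 0) add by move=> x; rewrite -(mkK x) addE add0r.
pose m1 := GRing.isNmodule.Build T addA addC add0.
pose Tn : nmodType := HB.pack T m1.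
pose mult : Tn -> Tn -> Tn := mul.
have multE x y : mult (mk x) (mk y) = mk (x * y) by apply: mulE.
have plusE x y : (mk x : Tn) + (mk y : Tn) = mk (x + y) by apply: addE.
have mulA : associative mult.
  by move=> x y z; rewrite -(mkK x) -(mkK y) -(mkK z) !multE mulrA.
have mul1 : left_id (mk 1 : Tn) mult by move=> x; rewrite -(mkK x) multE mul1r.
have mulr1' : right_id (mk 1 : Tn) mult by move=> x; rewrite -(mkK x) multE mulr1.
have mulDl : left_distributive mult +%R.
  move=> x y z; rewrite -(mkK x) -(mkK y) -(mkK z).
  by rewrite plusE !multE plusE mulrDl.
have mulDr : right_distributive mult +%R.
  move=> x y z; rewrite -(mkK x) -(mkK y) -(mkK z).
  by rewrite plusE !multE plusE mulrDr.
have mul0 : left_zero (0 : Tn) mult.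
  by move=> x; rewrite -(mkK x); apply: etrans (multE 0 _) _; rewrite mul0r.
have mulr0' : right_zero (0 : Tn) mult.
  by move=> x; rewrite -(mkK x); apply: etrans (multE _ 0) _; rewrite mulr0.
pose m2 := GRing.Nmodule_isPzSemiRing.Build Tn mulA mul1 mulr1' mulDl mulDr mul0 mulr0'.
pose Tr : pzSemiRingType := HB.pack T m1 m2.
have [||||p pE] := @ex_rmorphism S Tr mk.
- by [].
- by [].
- by move=> x y; apply/esym/plusE.
- by move=> x y; apply/esym/multE.
by exists Tr, p, (fun x : T => \val x); split=> [x|y]; rewrite pE //; apply: mkK.
Qed.

Lemma ex_ring (Q : pzSemiRingType) : invertible (1 : Q) ->
  exists (R : pzRingType) (f : {rmorphism Q -> R}), bijective f.
Proof.
move=> [n n1].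
have addN : left_inverse (0 : Q) ( *%R n) +%R.
  by move=> x; rewrite -[X in _ + X]mul1r -mulrDl addrC n1 mul0r.
pose m := GRing.Nmodule_isZmodule.Build Q addN.
pose R : pzRingType := HB.pack (GRing.PzSemiRing.sort Q) m.
have [||||f fE] := @ex_rmorphism Q R (fun x : Q => x) => //.
by exists R, f, (fun x : R => x : Q) => x; rewrite fE.
Qed.

(** * Finiteness *)

(** The 2-adic valuation of n + 1 takes the value i at n + 1 = 2^i (2 N + 1), for every N. *)
Lemma infinite_fibres :
  exists c : nat -> nat, forall i N, exists p, (N <= p)%N /\ c p = i.
Proof.
exists (fun n => logn 2 n.+1) => i N; exists (2 ^ i * N.*2.+1).-1.
have m0 : (0 < 2 ^ i * N.*2.+1)%N by rewrite muln_gt0 expn_gt0.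
split.
  rewrite -ltnS prednK //; apply: leq_trans (leq_pmull _ _); last by rewrite expn_gt0.
  by rewrite ltnS -addnn leq_addr.
by rewrite prednK // lognM ?expn_gt0 // pfactorK // lognE /= dvdn2 /= odd_double addn0.
Qed.

Lemma uniform_bound (P : nat -> nat -> Prop) n :
  (forall i, (i < n)%N -> exists N, forall p, (N <= p)%N -> P i p) ->
  exists N, forall i p, (i < n)%N -> (N <= p)%N -> P i p.
Proof.
elim: n => [|n IH] h; first by exists 0.
have [|N hN] := IH; first by move=> i lt; apply: h; rewrite ltnS ltnW.
have [N' hN'] := h n (ltnSn n); exists (maxn N N') => i p.
rewrite ltnS leq_eqVlt geq_max => /orP[/eqP->|lt] /andP[? ?]; first exact: hN'.
exact: hN.
Qed.

(* Split nat into infinitely many infinite fibres. Modulo "equal after right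
   multiplication by almost all z p", the elements supported on finitely many
   fibres and those meeting each fibre finitely have direct sum; the projection
   to the first summand is then not right multiplication by any u, because one
   can choose in each fibre a point where u acts as the identity. *)
Lemma no_separated_sequence (S : pzSemiRingType) (z : nat -> S) : cyclic_baer S ->
  (forall p, z p * z p = z p) -> (forall p, z p <> 0) ->
  (forall A : set nat, exists f, forall p,
     (A p -> f * z p = z p /\ z p * f = z p) /\ (~ A p -> f * z p = 0)) ->
  False.
Proof.
move=> baer zz z0 sep; have [c cE] := infinite_fibres.
pose E (r r' : S) := exists N, forall p, (N <= p)%N -> r * z p = r' * z p.
pose J0 (r : S) := exists N, forall p, (N <= c p)%N -> r * z p = 0.
pose J1 (r : S) := forall i, exists N, forall p, (N <= p)%N -> c p = i -> r * z p = 0.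
pose G (r m : S) := J0 m /\ exists r1, J1 r1 /\ r = m + r1.
have [||r m r' m'|s r m|r m m'|u uE] := baer E G.
- split=> [x|x y [N h]|x y w [N h] [N' h']|x x' y y' [N h] [N' h']|s x y [N h]].
  + by exists 0.
  + by exists N => p /h.
  + by exists (maxn N N') => p; rewrite geq_max => /andP[/h-> /h'].
  + exists (maxn N N') => p; rewrite geq_max => /andP[/h e /h' e'].
    by rewrite !mulrDl e e'.
  + by exists N => p /h e; rewrite /GRing.scale /= -!mulrA e.
- split; first by exists 0 => p _; rewrite mul0r.
  by exists 0; rewrite addr0; split=> // i; exists 0 => p; rewrite mul0r.
- move=> [[N h] [r1 [j1 ->]]] [[N' h'] [r1' [j1' ->]]]; split.
    exists (maxn N N') => p; rewrite geq_max => /andP[/h e /h' e'].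
    by rewrite mulrDl e e' addr0.
  exists (r1 + r1'); split; last by rewrite addrACA.
  move=> i; have [M k] := j1 i; have [M' k'] := j1' i.
  exists (maxn M M') => p; rewrite geq_max => /andP[/k e /k' e'] cp.
  by rewrite mulrDl e // e' // addr0.
- move=> [[N h] [r1 [j1 ->]]]; split.
    by exists N => p /h e; rewrite -mulrA e mulr0.
  exists (s * r1); split; last by rewrite mulrDr.
  move=> i; have [M k] := j1 i; exists M => p /k e /e {}e.
  by rewrite -mulrA e mulr0.
- move=> [[N h] [r1 [j1 ->]]] [[N' h'] [r1' [j1' e]]].
  (* On the finitely many fibres below the bound, [r1] and [r1'] vanish at almost all points,
     uniformly; on the other fibres [m] and [m'] vanish. *)
  have [i _|M hM] := @uniform_bound
      (fun i p => c p = i -> r1 * z p = 0 /\ r1' * z p = 0) (maxn N N').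
    have [M k] := j1 i; have [M' k'] := j1' i.
    by exists (maxn M M') => p; rewrite geq_max => /andP[/k ? /k' ?] ?; split; auto.
  exists M => p Mp; have [lt|] := ltnP (c p) (maxn N N'); last first.
    by rewrite geq_max => /andP[/h-> /h'->].
  have [e1 e1'] := hM _ _ lt Mp erefl.
  by have := congr1 ( *%R^~ (z p)) e; rewrite !mulrDl e1 e1' !addr0.
have J1_0 : J1 0 by move=> i; exists 0 => p _ _; rewrite mul0r.
(* The element separating fibre i lies in the first summand, so right multiplication by [u] fixes it
   at almost all points; take a point of the fibre far enough out. *)
have point i : exists p, [/\ (i <= p)%N, c p = i & z p * u * z p = z p].
  have [f fE] := sep [set p | c p = i].
  have [|N hN] := uE f f.
    split; last by exists 0; rewrite addr0.
    by exists i.+1 => p lt; have [_ ->] := fE p => // cp; rewrite cp ltnn in lt.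
  have [p [lp cp]] := cE i (maxn N i); move: lp; rewrite geq_max => /andP[/hN e ip].
  exists p; split=> //; have [+ _] := fE p => /(_ cp)[fz zf].
  by rewrite -[in RHS](zz p) -[in X in _ = _ * X]fz e !mulrA zf.
have /choice[q qE] := point.
(* The chosen points meet each fibre once, so [f] lies in the second summand and f u vanishes at
   almost all [z p]. At [q N] this contradicts z u z = z. *)
have [f fE] := sep (range q).
have [|N hN] := uE f 0.
  split; first by exists 0 => p _; rewrite mul0r.
  exists f; rewrite add0r; split=> // i; exists (q i).+1 => p lt cp.
  have [_ ->] := fE p => // -[j _ qj]; have [_ cq _] := qE j.
  by move: lt; rewrite -cp -qj cq ltnn.
have [Nq _ zuz] := qE N.
have [/(_ (imageT q N))[_ zf] _] := fE (q N).
apply: (z0 (q N)); rewrite -zuz -{1}zf -!mulrA; rewrite [f * _]mulrA -hN //.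
by rewrite mul0r mulr0.
Qed.

Definition orthogonal_idempotents (S : pzSemiRingType) (I : Type) (z : I -> S) :=
  (forall p, z p * z p = z p) /\ (forall p q, p <> q -> z p * z q = 0).

(** Modulo equality on all [z p], Baer's criterion realises by some [u] the projection that keeps
    elements vanishing off [A] and kills those vanishing on [A]. Commutativity lets this [u] act on
    both sides, so it separates [A]. *)
Lemma no_orthogonal_sequence_com (S : pzSemiRingType) (z : nat -> S) :
  cyclic_baer S -> (forall x y : S, x * y = y * x) ->
  orthogonal_idempotents z -> (forall p, z p <> 0) -> False.
Proof.
move=> baer com [zz zo] z0; apply: (no_separated_sequence baer zz z0) => A.
pose G (r m : S) := (forall p, ~ A p -> m * z p = 0) /\
  exists r1, (forall p, A p -> r1 * z p = 0) /\ r = m + r1.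
pose E (r r' : S) := forall p, r * z p = r' * z p.
have [||r m r' m'|s r m|r m m'|u uE] := baer E G.
- split=> [x p|x y h p|x y w h h' p|x x' y y' h h' p|s x y h p] //.
  + by rewrite h h'.
  + by rewrite !mulrDl h h'.
  + by rewrite /GRing.scale /= -!mulrA h.
- split; first by move=> p _; rewrite mul0r.
  by exists 0; rewrite addr0; split=> // p; rewrite mul0r.
- move=> [h [r1 [j1 ->]]] [h' [r1' [j1' ->]]]; split.
    by move=> p nA; rewrite mulrDl h // h' // addr0.
  exists (r1 + r1'); split; last by rewrite addrACA.
  by move=> p Ap; rewrite mulrDl j1 // j1' // addr0.
- move=> [h [r1 [j1 ->]]]; split.
    by move=> p nA; rewrite -mulrA h // mulr0.
  exists (s * r1); split; last by rewrite mulrDr.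
  by move=> p Ap; rewrite -mulrA j1 // mulr0.
- move=> [h [r1 [j1 ->]]] [h' [r1' [j1' e]]] p.
  have [Ap|nA] := pselect (A p); last by rewrite h // h'.
  by have := congr1 ( *%R^~ (z p)) e; rewrite !mulrDl j1 // j1' // !addr0.
exists u => p; split=> Ap.
  suff uz : z p * u = z p by split=> //; rewrite com.
  have /uE/(_ p) : G (z p) (z p).
    split; first by move=> q nA; apply: zo => e; apply: nA; rewrite -e.
    by exists 0; rewrite addr0; split=> // q; rewrite mul0r.
  by rewrite zz com mulrA zz => {1}<-.
have /uE/(_ p) : G (z p) 0.
  split; first by move=> q _; rewrite mul0r.
  exists (z p); rewrite add0r; split=> // q Aq.
  by apply: zo => e; apply: Ap; rewrite e.
by rewrite mul0r com mulrA zz com.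
Qed.

(** Baer's criterion yields right multiplications only, while separation also concerns products from
    the left. The remedy is an element [u] such that u v depends only on the products z q v; the
    idempotents u z p can then be separated. *)
Lemma no_orthogonal_sequence_ring (R : pzRingType) (z : nat -> R) :
  cyclic_baer R -> orthogonal_idempotents z -> (forall p, z p <> 0) -> False.
Proof.
move=> baer [zz zo] z0.
pose s n := \sum_(i < n) z i.
have zs p n : (p < n)%N -> z p * s n = z p.
  move=> pn; rewrite mulr_sumr (bigD1 (Ordinal pn)) //= zz big1 ?addr0 //.
  by move=> j /eqP nj; apply: zo => pj; apply: nj; apply: val_inj.
(* The left ideal generated by all [z p]. *)
pose fin (r : R) := exists N, forall n, (N <= n)%N -> r * s n = r.
have fin0 : fin 0 by exists 0 => n _; rewrite mul0r.
have finD x y : fin x -> fin y -> fin (x + y).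
  move=> [N h] [N' h']; exists (maxn N N') => n.
  by rewrite geq_max mulrDl => /andP[/h-> /h'->].
have finM x y : fin y -> fin (x * y).
  by move=> [N h]; exists N => n /h e; rewrite -mulrA e.
have fin_z p : fin (z p) by exists p.+1 => n; apply: zs.
have fin_inj x y : fin x -> fin y -> (forall p, x * z p = y * z p) -> x = y.
  move=> [N h] [N' h'] e; pose n := maxn N N'.
  rewrite -(h n) ?leq_maxl // -(h' n) ?leq_maxr // !mulr_sumr.
  by apply: eq_bigr.
have fin_ann x k : fin x -> (forall p, z p * k = 0) -> x * k = 0.
  move=> [N h] zk; rewrite -(h N) // -mulrA mulr_suml big1 => [|i _]; last exact: zk.
  by rewrite mulr0.
(* Here [f] extends the projection of [fin] onto the part spanned by the [z p] with p in [A]. *)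
have left_mul A : exists f, forall p, (A p -> z p * f = z p) /\ (~ A p -> z p * f = 0).
  pose G (r m : R) := (fin m /\ forall p, ~ A p -> m * z p = 0) /\
    exists r1, (fin r1 /\ forall p, A p -> r1 * z p = 0) /\ r = m + r1.
  have [||r m r' m'|t r m|r m m'|u uE] := baer eq G.
  - exact: eq_congruence.
  - split; first by split=> // p _; rewrite mul0r.
    by exists 0; rewrite addr0; split=> //; split=> // p; rewrite mul0r.
  - move=> [[fm h] [r1 [[f1 j1] ->]]] [[fm' h'] [r1' [[f1' j1'] ->]]]; split.
      by split; [exact: finD|move=> p nA; rewrite mulrDl h // h' // addr0].
    exists (r1 + r1'); split; last by rewrite addrACA.
    by split; [exact: finD|move=> p Ap; rewrite mulrDl j1 // j1' // addr0].
  - move=> [[fm h] [r1 [[f1 j1] ->]]]; split.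
      by split; [exact: finM|move=> p nA; rewrite -mulrA h // mulr0].
    exists (t * r1); split; last by rewrite mulrDr.
    by split; [exact: finM|move=> p Ap; rewrite -mulrA j1 // mulr0].
  - move=> [[fm h] [r1 [[f1 j1] ->]]] [[fm' h'] [r1' [[f1' j1'] e]]].
    apply: fin_inj => // p.
    have [Ap|nA] := pselect (A p); last by rewrite h // h'.
    by have := congr1 ( *%R^~ (z p)) e; rewrite !mulrDl j1 // j1' // !addr0.
  exists u => p; split=> Ap.
    apply/esym/uE; split.
      by split=> // q nA; apply: zo => e; apply: nA; rewrite -e.
    by exists 0; rewrite addr0; split=> //; split=> // q; rewrite mul0r.
  apply/esym/uE; split; first by split=> // q _; rewrite mul0r.
  exists (z p); rewrite add0r; split=> //; split=> // q Aq.
  by apply: zo => e; apply: Ap; rewrite e.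
have sT : subsemimodule [set: R^o] by [].
have [C [[C0 CD CZ] _ Cfin Cmax]] := max_disjoint_submodule sT fin0.
have CN x : C x -> C (- x) by rewrite -mulN1r; apply: (CZ (-1)).
have finN x : fin x -> fin (- x) by rewrite -mulN1r; apply: finM.
(* By maximality of [C] the left ideal fin + C is essential: every nonzero left ideal meets it
   nontrivially. *)
have ess (x : R) : x <> 0 -> exists r n c, [/\ r * x <> 0, fin n, C c & r * x = n + c].
  move=> x0; have [Cx|nCx] := pselect (C x).
    by exists 1, 0, x; rewrite mul1r add0r.
  apply: contrapT => no; apply: nCx.
  apply: (Cmax [set y | exists c r, C c /\ y = c + r * x] _ _ _ _).
  - split; first by exists 0, 0; rewrite mul0r addr0.
      move=> _ _ [c [r [Cc ->]]] [c' [r' [Cc' ->]]]; exists (c + c'), (r + r').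
      by split; [exact: CD|rewrite mulrDl addrACA].
    move=> t _ [c [r [Cc ->]]]; exists (t * c), (t * r).
    by split; [exact: CZ|rewrite /GRing.scale /= mulrDr mulrA].
  - by move=> y Cy; exists y, 0; rewrite mul0r addr0.
  - by [].
  - move=> _ [c [r [Cc ->]]] fy; apply: contrapT => y0; apply: no.
    exists r, (c + r * x), (- c); split; [|by []|exact: CN|by rewrite addrC addKr].
    by move=> rx0; apply: y0; rewrite rx0 addr0 in fy *; apply: Cfin.
  - by exists 0, 1; rewrite mul1r add0r.
(* The graph of the projection of fin + C onto [fin]. *)
pose G (r m : R) := fin m /\ exists c, C c /\ r = m + c.
have [||r m r' m'|t r m|r m m'|u uE] := baer eq G.
- exact: eq_congruence.
- by split=> //; exists 0; rewrite addr0.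
- move=> [fm [c [Cc ->]]] [fm' [c' [Cc' ->]]]; split; first exact: finD.
  by exists (c + c'); split; [exact: CD|rewrite addrACA].
- move=> [fm [c [Cc ->]]]; split; first exact: finM.
  by exists (t * c); split; [exact: CZ|rewrite mulrDr].
- move=> [fm [c [Cc ->]]] [fm' [c' [Cc' e]]]; apply/eqP; rewrite -subr_eq0; apply/eqP.
  apply: Cfin; last by apply: finD => //; apply: finN.
  have -> : m - m' = c' - c; last by apply: CD => //; apply: CN.
  by apply/eqP; rewrite subr_eq addrAC eq_sym subr_eq addrC -e addrC.
have un n : fin n -> n * u = n.
  by move=> fn; apply/esym/uE; split=> //; exists 0; rewrite addr0.
have uc c : C c -> c * u = 0.
  by move=> Cc; apply/esym/uE; split=> //; exists c; rewrite add0r.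
(* Otherwise regularity gives a nonzero idempotent g = u k y, and some nonzero r g lies in fin + C,
   say r g = n + c. Then r g = r g g = (n + c) u k y = n k y = 0. *)
have uk k : (forall p, z p * k = 0) -> u * k = 0.
  move=> zk; apply: contrapT => /eqP/eqP q0.
  have [y yE] := cyclic_baer_regular baer (u * k).
  pose g := u * k * y.
  have gg : g * g = g by rewrite /g mulrA yE.
  have gq : g * (u * k) = u * k by rewrite /g yE.
  have [|r [n [c [rg fn Cc e]]]] := ess g.
    by move=> g0; rewrite g0 mul0r in gq; case: q0.
  apply: rg; rewrite -gg mulrA e /g !mulrA mulrDl un // uc // addr0.
  by rewrite (fin_ann n k) // mul0r.
pose z' p := u * z p.
have zu p : z p * u = z p by apply: un.
apply: (@no_separated_sequence R z') => // [p|p|A].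
- by rewrite /z' -mulrA [z p * _]mulrA zu zz.
- by move=> e; apply: (z0 p); rewrite -(zz p) -{1}(zu p) -mulrA -/(z' p) e mulr0.
have [f fE] := left_mul A; exists (u * f) => p.
have sub v : (forall q, z q * (f * (u * z p)) = z q * v) -> u * f * z' p = u * v.
  move=> h; apply/eqP; rewrite -subr_eq0 -mulrA -mulrBr; apply/eqP/uk => q.
  by rewrite mulrBr h subrr.
have zfz q : z q * (f * (u * z p)) =
    if q == p then (if `[< A p >] then z p else 0) else 0.
  rewrite mulrA; have [->|/eqP qp] := eqVneq q p.
    case: asboolP => Ap; first by rewrite (fE p).1 // mulrA zu zz.
    by rewrite (fE p).2 // mul0r.
  have [Aq|nA] := pselect (A q); last by rewrite (fE q).2 // mul0r.
  by rewrite (fE q).1 // mulrA zu zo.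
split=> Ap; last first.
  rewrite (sub 0) ?mulr0 // => q; rewrite zfz mulr0.
  by case: eqP => // _; case: asboolP.
split.
  apply: sub => q; rewrite zfz; case: eqVneq => [->|/eqP qp]; last by rewrite zo.
  by case: asboolP => // _; rewrite zz.
by rewrite /z' -mulrA [z p * _]mulrA zu (fE p).1.
Qed.

(** * Decomposing 1 into simple orthogonal idempotents *)

(** Every nonzero element of S a generates S a. Idempotency of [a] is stated separately where it is
    used. *)
Definition simple_idempotent (S : pzSemiRingType) (a : S) :=
  a <> 0 /\ forall x, x * a <> 0 -> exists y, y * (x * a) = a.

Definition decomposable (S : pzSemiRingType) (a : S) :=
  exists (I : finType) (z : I -> S),
    [/\ orthogonal_idempotents z, forall i, simple_idempotent (z i) & \sum_i z i = a].

Definition orthogonal_sum (S : pzSemiRingType) (b c a : S) :=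
  [/\ b * b = b, c * c = c, b * c = 0, c * b = 0 & b + c = a].

Section Decomposition.
Variable S : pzSemiRingType.
Implicit Types a b c : S.

Lemma decomposable0 : decomposable (0 : S).
Proof. by exists 'I_0, (fun=> 0); split; [split; case|case|rewrite big_ord0]. Qed.

Lemma orthogonal_sumE (I : finType) (z : I -> S) i : orthogonal_idempotents z ->
  z i * (\sum_j z j) = z i /\ (\sum_j z j) * z i = z i.
Proof.
move=> [zz zo]; split.
  rewrite mulr_sumr (bigD1 i) //= zz big1 ?addr0 // => j /eqP ji.
  by apply: zo => ij; apply: ji.
by rewrite mulr_suml (bigD1 i) //= zz big1 ?addr0 // => j /eqP; apply: zo.
Qed.

Lemma decomposableD a b c : orthogonal_sum b c a ->
  decomposable b -> decomposable c -> decomposable a.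
Proof.
move=> [bb cc bc cb <-] [I [z [[zz zo] zs zb]]] [J [w [[ww wo] ws wc]]].
have zbE i : z i * b = z i /\ b * z i = z i.
  rewrite -zb; exact: orthogonal_sumE.
have wcE i : w i * c = w i /\ c * w i = w i.
  rewrite -wc; exact: orthogonal_sumE.
exists (I + J)%type, (fun k => match k with inl i => z i | inr j => w j end); split.
- split=> [[i|j]|[i|j] [i'|j'] ne] //.
  + by apply: zo => e; apply: ne; rewrite e.
  + by rewrite -(zbE i).1 -(wcE j').2 mulrA -[z i * b * c]mulrA bc mulr0 mul0r.
  + by rewrite -(wcE j).1 -(zbE i').2 mulrA -[w j * c * b]mulrA cb mulr0 mul0r.
  + by apply: wo => e; apply: ne; rewrite e.
- by case.
- by rewrite big_sumType /= zb wc.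
Qed.

Hypothesis split_idempotent : forall a, a * a = a -> a <> 0 ->
  ~ simple_idempotent a ->
  exists b c, [/\ b <> 0, c <> 0 & orthogonal_sum b c a].
Hypothesis no_sequence : forall z : nat -> S,
  orthogonal_idempotents z -> (forall p, z p <> 0) -> False.

(* Otherwise one can forever split off a nonzero summand from 1. *)
Lemma decomposable1 : decomposable (1 : S).
Proof.
apply: contrapT => bad1.
pose bad a := a * a = a /\ ~ decomposable a.
(* At least one summand of a bad element is bad. It comes first in the pair and is split further;
   the second component is the nonzero piece set aside. *)
have /choice[next nextE] : forall a, exists bd,
    bad a -> [/\ bad bd.1, bd.2 <> 0 & orthogonal_sum bd.1 bd.2 a].
  move=> a; have [[aa nd]|nb] := pselect (bad a); last by exists (0, 0).
  have a0 : a <> 0 by move=> a0; apply: nd; rewrite a0; apply: decomposable0.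
  have [|b [c [b0 c0 bca]]] := split_idempotent aa a0.
    move=> sa; apply: nd; exists 'I_1, (fun=> a); rewrite big_ord1.
    by split=> //; split=> // p q []; rewrite !ord1.
  have [bb cc bc cb sum] := bca.
  have [db|ndb] := pselect (decomposable b); last by exists (b, c).
  exists (c, b) => _; split=> //; first split=> //.
    by move=> dc; apply: nd; apply: decomposableD db dc.
  by split=> //; rewrite addrC.
pose e n := iter n (fun a => (next a).1) 1; pose z n := (next (e n)).2.
have be n : bad (e n).
  elim: n => [|n /nextE[]//]; by split=> //; rewrite mulr1.
have eS n : orthogonal_sum (e n.+1) (z n) (e n) by have [] := nextE _ (be n).
have ze n : z n * e n = z n /\ e n * z n = z n.
  by have [_ zz ez ze' <-] := eS n; rewrite mulrDr mulrDl ze' ez zz !add0r.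
have ee n k : e (n + k)%N * e n = e (n + k)%N /\ e n * e (n + k)%N = e (n + k)%N.
  elim: k => [|k [IH1 IH2]]; first by rewrite addn0; have [-> _] := be n.
  have [f1 f2] : e (n + k)%N%N.+1 * e (n + k)%N = e (n + k)%N%N.+1 /\
      e (n + k)%N * e (n + k)%N%N.+1 = e (n + k)%N%N.+1.
    have [fe _ ez zf sum] := eS (n + k)%N.
    by rewrite -sum mulrDr mulrDl ez zf fe !addr0.
  by rewrite addnS; split; [rewrite -f1 -mulrA IH1|rewrite -f2 mulrA IH2].
(* Later pieces lie under [e n.+1], which is orthogonal to [z n]. *)
have zo n k : z n * z (n + k)%N.+1 = 0 /\ z (n + k)%N.+1 * z n = 0.
  have [_ _ ez zE _] := eS n.
  have [e1 e2] := ee n.+1 k; rewrite addSn in e1 e2.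
  have [z1 z2] := ze (n + k)%N%N.+1.
  split; first by rewrite -z2 -e2 !mulrA zE !mul0r.
  by rewrite -z1 -e1 -!mulrA ez !mulr0.
apply: (no_sequence (z := z)) => [|p]; last by have [] := nextE _ (be p).
split=> [p|p q /eqP]; first by have [] := eS p.
rewrite neq_ltn => /orP[] /subnK <-; rewrite addnC addSn.
  by have [] := zo p (q - p.+1)%N.
by have [] := zo q (p - q.+1)%N.
Qed.

End Decomposition.

(** If x a is nonzero and does not generate R a, regularity gives an idempotent h with R h = R x a.
    Then a h is an idempotent generating the same left ideal, and a - a h is its nonzero
    complement. *)
Lemma ring_split_idempotent (R : pzRingType) (a : R) :
  (forall x : R, exists u, x * u * x = x) -> a * a = a -> a <> 0 ->
  ~ simple_idempotent a -> exists b c, [/\ b <> 0, c <> 0 & orthogonal_sum b c a].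
Proof.
move=> reg aa a0 ns.
have [x [xa0 xy]] : exists x, x * a <> 0 /\ forall y, y * (x * a) <> a.
  apply: contrapT => no; apply: ns; split=> // x xa0.
  by apply: contrapT => nx; apply: no; exists x; split=> // y yxa; apply: nx; exists y.
have [u uE] := reg (x * a); pose h := u * (x * a).
have hh : h * h = h by rewrite /h -mulrA (mulrA (x * a)) uE.
have ha : h * a = h by rewrite /h -!mulrA aa.
have ahh : a * h * (a * h) = a * h by rewrite mulrA -(mulrA a h a) ha -mulrA hh.
exists (a * h), (a - a * h); split.
- by move=> ah; apply: xa0; rewrite -uE -mulrA -/h -mulrA ah mulr0.
- by move=> /eqP; rewrite subr_eq0 => /eqP e; apply: (xy (a * u)); rewrite -mulrA -/h.
- split=> //; last by rewrite addrC subrK.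
  + by rewrite mulrBr !mulrBl aa ahh mulrA aa -(mulrA a h a) ha subrr subr0.
  + by rewrite mulrBr -(mulrA a h a) ha ahh subrr.
  + by rewrite mulrBl mulrA aa ahh subrr.
Qed.

(** The simple summands are the left ideals R z i, and the component of x in R z i is x z i. *)
Lemma decomposable_semisimple (R : pzRingType) :
  decomposable (1 : R) -> semisimple_ring R.
Proof.
move=> [I [z [[zz zo] zs z1]]].
exists I, (fun i => [set x | x * z i = x]); split=> [i|x].
  have [zi0 zi] := zs i; split.
  - split=> [|x y xz yz|s x xz]; first exact: mul0r.
      by rewrite /= mulrDl xz yz.
    by rewrite /= -mulrA xz.
  - move=> e; apply: zi0; have : [set x | x * z i = x] (z i) by apply: zz.
    by rewrite e.
  - move=> N [N0 ND NZ] NL.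
    have [[x [Nx x0]]|no] := pselect (exists x, N x /\ x <> 0); [right|left].
      apply/seteqP; split=> // y yz.
      have xz : x * z i = x by apply: NL.
      have [|t tE] := zi x; first by rewrite xz.
      by rewrite -yz -tE xz mulrA; apply: NZ.
    apply/seteqP; split=> [y Ny|_ ->//].
    by apply: contrapT => y0; apply: no; exists y.
have big (y : I -> R) : \sum_(i \in [set: I]) y i = \sum_i y i.
  rewrite (fsbigE (index_enum I)) ?index_enum_uniq //; first last.
    by move=> i _; rewrite mem_index_enum.
  by apply: eq_bigl => i; rewrite classical_sets.in_setT.
exists (fun i => x * z i); split.
  split=> [i||]; last by rewrite big -mulr_sumr z1 mulr1.
    by rewrite /= -mulrA zz.
  exact: finite_finset.
move=> y [yz _ ->]; apply: funext => i; rewrite big mulr_suml (bigD1 i) //= yz.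
rewrite big1 ?addr0 // => j /eqP ji; rewrite -(yz j) -mulrA zo ?mulr0 //.
Qed.

(** * The Boolean part *)

Lemma left_subtractive_surj (S S' : pzSemiRingType) (f : {rmorphism S -> S'}) :
  (forall y, exists x, f x = y) -> left_subtractive S -> left_subtractive S'.
Proof.
move=> surj hS A [A0 AD AZ] m m'.
have [x <-] := surj m; have [y <-] := surj m'.
have sfA : subsemimodule (f @^-1` A : set S^o).
  split; first by rewrite /preimage /= rmorph0.
    by move=> a b; rewrite /preimage /= rmorphD; apply: AD.
  by move=> s a; rewrite /preimage /= rmorphM; apply: AZ.
by move=> Ax Axy; apply: (hS _ sfA x y Ax); rewrite /preimage /= rmorphD.
Qed.

Section BooleanPart.
Variable T : pzSemiRingType.
Hypothesis baer : cyclic_baer T.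
Hypothesis subT : left_subtractive T.
Hypothesis top : forall x : T, 1 + x = 1.
Hypothesis compl : forall a : T, a * a = a -> exists b, a + b = 1 /\ a * b = 0.

(** With a = a u a, the sum a + u a equals both (1 + u) a = a and (a + 1) u a = u a. Hence a = u a
    and a a = a u a = a. *)
Lemma top_idem (a : T) : a * a = a.
Proof.
have [u uE] := cyclic_baer_regular baer a.
suff e : a = u * a by rewrite {2}e mulrA uE.
have <- : a + u * a = u * a.
  by rewrite -{1}uE -mulrA -[X in _ + X]mul1r -mulrDl addrC top mul1r.
by rewrite -{2}[a]mul1r -mulrDl top mul1r.
Qed.

(** The left ideal T a is subtractive and contains both a and a + x. *)
Lemma top_le (x a : T) : a + x = a -> x * a = x.
Proof.
move=> ax; pose A : set T^o := [set r | r * a = r].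
have sA : subsemimodule A.
  split; first exact: mul0r.
    by move=> r s ra sa; rewrite /A /= mulrDl ra sa.
  by move=> s r ra; rewrite /A /= -mulrA ra.
have Aa : A a by apply: top_idem.
by apply: (subT sA Aa); rewrite ax.
Qed.

(** Since x + x y = x, [top_le] gives x y x = x y, so x y + y x = (x + 1) y x = y x. By symmetry the
    same sum equals x y. *)
Lemma top_com (a b : T) : a * b = b * a.
Proof.
have le (x y : T) : x * y + y * x = y * x.
  have <- : x * y * x = x * y by apply: top_le; rewrite -{1}[x]mulr1 -mulrDr top mulr1.
  by rewrite -mulrA -{2}[y * x]mul1r -mulrDl addrC top mul1r.
by rewrite -(le b a) addrC le.
Qed.

Lemma top_addxx (a : T) : a + a = a.
Proof. by rewrite -{1 2}[a]mul1r -mulrDl top mul1r. Qed.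

Lemma top_add0 (a b : T) : a + b = 0 -> a = 0 /\ b = 0.
Proof.
move=> ab; split; first by rewrite -[a]addr0 -ab addrA top_addxx ab.
by rewrite -[b]addr0 -ab addrCA top_addxx ab.
Qed.

Lemma top_split (a : T) : a * a = a -> a <> 0 -> ~ simple_idempotent a ->
  exists b c, [/\ b <> 0, c <> 0 & orthogonal_sum b c a].
Proof.
move=> aa a0 ns.
have [x [xa0 xy]] : exists x, x * a <> 0 /\ x * a <> a.
  apply: contrapT => no; apply: ns; split=> // x xa0.
  by exists 1; rewrite mul1r; apply: contrapT => nx; apply: no; exists x.
have [b [b1 xab]] := compl (top_idem (x * a)).
have axa : a * (x * a) = x * a by rewrite top_com -mulrA aa.
have sum : x * a + a * b = a by rewrite -{1}axa -mulrDr b1 mulr1.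
have o : x * a * (a * b) = 0 by rewrite mulrA -(mulrA x) aa.
exists (x * a), (a * b); split=> //.
  by move=> ab; apply: xy; rewrite -[RHS]sum ab addr0.
by split=> //; rewrite ?top_idem // top_com.
Qed.

(** The [z i] act as atoms: x z i is 0 or z i. An element goes to the set of atoms below it, and a
    set of atoms to its sum. *)
Lemma boolean_part : exists I : finType,
  semiring_iso T (boolean_semiring {set I}).
Proof.
have [||I [z [zo zs z1]]] := @decomposable1 T.
- exact: top_split.
- by move=> z; apply: no_orthogonal_sequence_com => //; apply: top_com.
have [zz zd] := zo.
have sim i x : x * z i = 0 \/ x * z i = z i.
  have [->|/eqP xz] := eqVneq (x * z i) 0; first by left.
  have [_ /(_ x xz)[y yE]] := zs i; right.
  have : x * (y * (x * z i)) = y * (x * z i).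
    by rewrite mulrA (top_com x) -mulrA (mulrA x) top_idem.
  by rewrite yE.
have zn0 i : z i <> 0 by have [] := zs i.
pose F (x : T) : boolean_semiring {set I} := finset (fun i => x * z i != 0).
have FE x i : (i \in (F x : {set I})) = (x * z i != 0) by rewrite inE.
have dec x : x = \sum_i x * z i by rewrite -mulr_sumr z1 mulr1.
have [||||f fE] := @ex_rmorphism T (boolean_semiring {set I}) F.
- by apply/setP => i; rewrite FE mul0r eqxx inE.
- by apply/setP => i; rewrite FE mul1r inE; apply/eqP.
- move=> x y; apply/setP => i; rewrite !inE mulrDl.
  rewrite -negb_and; congr (~~ _).
  by apply/eqP/andP => [/top_add0[-> ->]|[/eqP-> /eqP->]]; rewrite ?eqxx ?addr0.
- move=> x y; apply/setP => i; rewrite !inE.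
  have [e|e] := sim i y; rewrite -mulrA e ?mulr0 ?eqxx ?andbF //.
  by have /eqP-> := zn0 i; rewrite andbT.
exists I, f; exists (fun A : {set I} => \sum_(i in A) z i) => [x|A].
  rewrite fE [RHS]dec [RHS](bigID (fun i => i \in (F x : {set I}))) /=.
  rewrite [X in _ = _ + X]big1 ?addr0 => [|i]; last by rewrite FE negbK => /eqP.
  by apply: eq_bigr => i; rewrite FE => /eqP; have [->|->] := sim i x.
rewrite fE; apply/setP => i; rewrite inE.
have [iA|iA] := boolP (i \in A).
  rewrite mulr_suml (bigD1 i) //= zz big1 ?addr0; first exact/eqP.
  by move=> j /andP[_ /eqP ji]; apply: zd.
apply/negbTE; rewrite negbK mulr_suml big1 // => j jA; apply: zd => ji.
by rewrite -ji jA in iA.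
Qed.

End BooleanPart.

(** * From cyclic e-injectivity to the product decomposition *)

Lemma cyclic_e_injective_decomposition (S : pzSemiRingType) :
  left_subtractive S ->
  (forall M : lSemiModType S, cyclic_semimodule M -> e_injective M) ->
  exists (R : pzRingType) (d : Order.disp_t) (T : finCTBDistrLatticeType d),
    semisimple_ring R /\ semiring_iso S (R * boolean_semiring T)%type.
Proof.
move=> hS cyc.
have baer := cyclic_e_injective_baer hS cyc.
have [e [f [t [Vf ef1 [ee ff] [ef fe] [ce cf et absorb]]]]] := splitting hS cyc.
have [T [p [i [ip pi]]]] := ex_corner ee ce.
have [R0 [q0 [j0 [jq0 qj0]]]] := ex_corner ff cf.
have q0f : q0 f = 1 by rewrite -[f]mulr1 -jq0 qj0 rmorph1.
have pe : p e = 1 by rewrite -[e]mulr1 -ip pi rmorph1.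
have q0e : q0 e = 0 by rewrite -[q0 e]mul1r -q0f -rmorphM fe rmorph0.
have pf : p f = 0 by rewrite -[p f]mul1r -pe -rmorphM ef rmorph0.
have [R [r [r' rK rK']]] : exists (R : pzRingType) (r : {rmorphism R0 -> R}), bijective r.
  apply: ex_ring; have [g fg] := Vf.
  by exists (q0 g); rewrite -q0f -rmorphD fg rmorph0.
have surj_p y : exists x, p x = y by exists (i y).
pose q : {rmorphism S -> R} := r \o q0.
have surj_q y : exists x, q x = y by exists (j0 (r' y)); rewrite /= qj0 rK'.
have topT (y : T) : 1 + y = 1.
  have [x <-] := surj_p y.
  (* The left ideal S t contains t = e + t, hence e by subtractivity. Multiplying t x + t = t by [c]
     then gives e x + e = e. *)
  have [c ct] : exists c, c * t = e.
    pose A : set S^o := [set s | exists c, c * t = s].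
    have sA : subsemimodule A.
      split; first by exists 0; rewrite mul0r.
        by move=> _ _ [c <-] [c' <-]; exists (c + c'); rewrite mulrDl.
      by move=> s _ [c <-]; exists (s * c); rewrite -mulrA.
    have At : A t by exists 1; rewrite mul1r.
    by apply: (hS _ sA t _ At); rewrite -{1}[e]mulr1 addrC absorb.
  have ex : e + e * x = e.
    have := congr1 ( *%R c) (absorb (t * x)).
    by rewrite mulrA et mulrDr mulrA ct addrC.
  by rewrite -[p x]mul1r -pe -rmorphM -rmorphD ex.
have [I [h [h' hK hK']]] : exists I : finType, semiring_iso T (boolean_semiring {set I}).
  apply: boolean_part => //.
  - exact: cyclic_baer_surj baer.
  - exact: left_subtractive_surj hS.
  - move=> a aa; pose b := i a.
    have pb : p b = a by apply: pi.
    have bb : b * b = b.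
      have bE : e * b = b by rewrite -ip pb.
      by rewrite -{1}bE -mulrA -ip rmorphM pb aa.
    (* Equating 1 with b yields 1 + k = b + k', whose left side maps to the top element 1 of [T]; so
       the image of [k'] is the complement of [a]. *)
    have [|k [k' [_ bk' kE]]] := @idempotent_equates S hS cyc b 1 b bb.
      by rewrite mulr1 bb.
    exists (p k'); split; last by rewrite -pb -rmorphM bk' rmorph0.
    by rewrite -(topT (p k)) -(rmorph1 p) -rmorphD kE rmorphD pb.
exists R, _, {set I}; split.
  apply: decomposable_semisimple.
  have baerR : cyclic_baer R by apply: cyclic_baer_surj baer.
  apply: decomposable1 => [a|z]; last exact: no_orthogonal_sequence_ring.
  exact/ring_split_idempotent/cyclic_baer_regular.
have [||||F FE] := @ex_rmorphism S (R * boolean_semiring {set I})%type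
    (fun s => (q s, h (p s))).
- by rewrite !rmorph0.
- by rewrite !rmorph1.
- by move=> x y; rewrite !rmorphD.
- by move=> x y; rewrite !rmorphM.
exists F; exists (fun y => f * j0 (r' y.1) + e * i (h' y.2)) => [x|[y1 y2]].
  by rewrite FE /= rK hK jq0 ip !mulrA ff ee addrC -mulrDl ef1 mul1r.
rewrite FE /= !rmorphD !rmorphM q0e q0f pe pf !rmorph0 !rmorph1.
by rewrite !mul1r !mul0r addr0 add0r qj0 pi rK' hK'.
Qed.

(** * Semimodules over a product of a ring and a Boolean algebra *)

Lemma leIl_joinC d (T : ctbDistrLatticeType d) (t s u : T) :
  (t `&` s <= u)%O = (t <= u `|` ~` s)%O.
Proof.
apply/idP/idP => h.
  rewrite -[t]meetx1 -(joinxC s) meetUr; apply: leU2 h _; exact: leIr.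
by apply: le_trans (leI2 h (lexx s)) _; rewrite meetUl meetCx joinx0 leIl.
Qed.

Section Decomposed.
Variables (S : pzSemiRingType) (R : pzRingType) (d : Order.disp_t).
Variable T : finCTBDistrLatticeType d.
Variable phi : {rmorphism S -> (R * boolean_semiring T)%type}.
Variable th : R * boolean_semiring T -> S.
Hypotheses (phiK : cancel phi th) (thK : cancel th phi).

Lemma thD x y : th (x + y) = th x + th y.
Proof. by apply: (can_inj phiK); rewrite rmorphD !thK. Qed.
Lemma thM x y : th (x * y) = th x * th y.
Proof. by apply: (can_inj phiK); rewrite rmorphM !thK. Qed.
Lemma th0 : th 0 = 0.
Proof. by apply: (can_inj phiK); rewrite rmorph0 thK. Qed.
Lemma th1 : th 1 = 1.
Proof. by apply: (can_inj phiK); rewrite rmorph1 thK. Qed.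

(** [rr] and [tt] embed the two factors as ideals of [S]. The elements [rr 1] and [tt \top] are
    complementary central idempotents, and [rr (-1)] acts as negation on the ring part of any
    semimodule. *)
Let rr (r : R) : S := th (r, 0).
Let tt (t : T) : S := th (0, t).
Let sT (s : S) : T := (phi s).2.

Lemma rrD x y : rr (x + y) = rr x + rr y.
Proof. by rewrite -thD; congr th; apply: injective_projections; rewrite /= ?addr0. Qed.
Lemma rrM x y : rr (x * y) = rr x * rr y.
Proof. by rewrite -thM; congr th; apply: injective_projections; rewrite /= ?mulr0. Qed.
Lemma rr0 : rr 0 = 0. Proof. exact: th0. Qed.
Lemma rrMl r s : rr r * s = rr (r * (phi s).1).
Proof.
rewrite -[s in LHS]phiK -thM; congr th.
by apply: injective_projections; rewrite /= ?mul0r.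
Qed.
Lemma rrMr r s : s * rr r = rr ((phi s).1 * r).
Proof.
rewrite -[s in LHS]phiK -thM; congr th.
by apply: injective_projections; rewrite /= ?mulr0.
Qed.
Lemma ttU x y : tt (x `|` y)%O = tt x + tt y.
Proof. by rewrite -thD; congr th; apply: injective_projections; rewrite /= ?addr0. Qed.
Lemma ttI x y : tt (x `&` y)%O = tt x * tt y.
Proof. by rewrite -thM; congr th; apply: injective_projections; rewrite /= ?mulr0. Qed.
Lemma tt_bot : tt \bot%O = 0. Proof. exact: th0. Qed.
Lemma ttMl t s : tt t * s = tt (t `&` sT s)%O.
Proof.
rewrite -[s in LHS]phiK -thM; congr th.
by apply: injective_projections; rewrite /= ?mul0r.
Qed.
Lemma ttMr t s : s * tt t = tt (t `&` sT s)%O.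
Proof.
rewrite -[s in LHS]phiK -thM; congr th.
apply: injective_projections; rewrite /= ?mulr0 //.
exact: meetC.
Qed.
Lemma rr1_tt1 : rr 1 + tt \top%O = 1.
Proof.
by rewrite -th1 -thD; congr th; apply: injective_projections; rewrite /= ?addr0 ?add0r.
Qed.
Lemma rrN : rr 1 + rr (-1) = 0. Proof. by rewrite -rrD subrr rr0. Qed.
Lemma rrN_com s : s * rr (-1) = rr (-1) * s.
Proof. by rewrite rrMl rrMr mulrN1 mulN1r. Qed.
Lemma rr1_com s : s * rr 1 = rr 1 * s.
Proof. by rewrite rrMl rrMr mulr1 mul1r. Qed.
Lemma tt_com s t : s * tt t = tt t * s.
Proof. by rewrite ttMl ttMr. Qed.

Lemma rrNb (N : lSemiModType S) (x : N) : rr 1 *: x + rr (-1) *: x = 0.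
Proof. by rewrite -scalerDl rrN scale0r. Qed.

Section Module.
Variables (B : lSemiModType S).
Implicit Types (b : B) (A : set B).

Hypothesis hR : semisimple_ring R.

Lemma ring_complement A : subsemimodule A -> exists C : set B,
  [/\ subsemimodule C, forall x, C x -> rr 1 *: x = x, forall x, C x -> A x -> x = 0
    & forall b, exists a c, [/\ A a, C c & rr 1 *: b = a + c]].
Proof.
move=> [A0 AD AZ]; pose D : set B := [set b | rr 1 *: b = b].
have sD : subsemimodule D.
  split=> [|x y xD yD|s x xD]; rewrite /D /=; first by rewrite scaler0.
    by rewrite scalerDr xD yD.
  by rewrite scalerA -rr1_com -scalerA xD.
have [C [[C0 CD CZ] CsD CA Cmax]] := max_disjoint_submodule sD A0.
exists C; split=> // b.
pose AC : set B := [set x | exists a c, [/\ A a, C c & x = a + c]].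
have AC0 : AC 0 by exists 0, 0; rewrite addr0.
have ACD x y : AC x -> AC y -> AC (x + y).
  move=> [a [c [Aa Cc ->]]] [a' [c' [Aa' Cc' ->]]]; exists (a + a'), (c + c').
  by split; [exact: AD|exact: CD|rewrite addrACA].
have ACZ s x : AC x -> AC (s *: x).
  move=> [a [c [Aa Cc ->]]]; exists (s *: a), (s *: c).
  by split; [exact: AZ|exact: CZ|rewrite scalerDr].
suff : AC (rr 1 *: b) by [].
have [I [L [Ls Lsum]]] := hR.
have [y [[Ly _ ->] _]] := Lsum 1.
have rr_sum (r : seq I) (P : pred I) F :
    rr (\sum_(i <- r | P i) F i) = \sum_(i <- r | P i) rr (F i).
  by apply: (big_morph rr); [exact: rrD|exact: rr0].
rewrite rr_sum scaler_suml; apply: big_ind => // i _.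
have [[L0 LD LZ] _ Lmin] := Ls i.
pose N : set R^o := [set r | L i r /\ AC (rr r *: b)].
have sN : subsemimodule N.
  split; first by split=> //; rewrite rr0 scale0r.
    by move=> u v [Lu ACu] [Lv ACv]; split; [exact: LD|rewrite rrD scalerDl; exact: ACD].
  move=> s u [Lu ACu]; split; first exact: LZ.
  by rewrite [rr _]rrM -scalerA; apply: ACZ.
(* If no nonzero r in [L i] sends b into A + C, then C + L i b still meets [A] only in 0, and
   maximality puts it inside [C]. *)
have [|N0|NL] := Lmin N sN; first by move=> u [].
  suff : C (rr (y i) *: b) by exists 0, (rr (y i) *: b); rewrite add0r.
  apply: (Cmax [set x | exists c r, [/\ C c, L i r & x = c + rr r *: b]]).
  - split; first by exists 0, 0; rewrite rr0 scale0r addr0.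
      move=> _ _ [c [u [Cc Lu ->]]] [c' [u' [Cc' Lu' ->]]]; exists (c + c'), (u + u').
      by split; [exact: CD|exact: LD|rewrite rrD scalerDl addrACA].
    move=> s _ [c [u [Cc Lu ->]]]; exists (s *: c), ((phi s).1 * u).
    by split; [exact: CZ|exact: LZ|rewrite scalerDr scalerA rrMr].
  - by move=> c Cc; exists c, 0; rewrite rr0 scale0r addr0.
  - move=> _ [c [u [Cc Lu ->]]]; rewrite /D /= scalerDr CsD // scalerA.
    by rewrite -rrM mul1r.
  - move=> _ [c [u [Cc Lu ->]]] Acu.
    have : N u.
      split=> //; exists (c + rr u *: b), (rr (-1) *: c); split=> //; first exact: CZ.
      by rewrite addrAC -{1}(CsD c Cc) rrNb add0r.
    rewrite N0 => u0; rewrite u0 rr0 scale0r addr0 in Acu *.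
    exact: CA.
  - by exists 0, (y i); rewrite add0r.
by have [] : N (y i) by rewrite NL.
Qed.

Lemma ring_projection A : subsemimodule A -> exists p : {linear B -> B},
  (forall b, A (p b)) /\ forall a, A a -> p a = rr 1 *: a.
Proof.
move=> sA; have [C [[C0 CD CZ] CsD CA dec]] := ring_complement sA.
have [A0 AD AZ] := sA.
(* Requiring [rr 1 *: a = a] places a in the ring part, where differences exist; this makes the
   component in [A] unique. *)
pose good b a := [/\ A a, rr 1 *: a = a & exists c, C c /\ rr 1 *: b = a + c].
have ff x : rr 1 *: (rr 1 *: x) = rr 1 *: x :> B by rewrite scalerA -rrM mul1r.
have goodE b : exists a, good b a.
  have [a [c [Aa Cc e]]] := dec b; exists (rr 1 *: a); split; [exact: AZ|exact: ff|].
  by exists c; split=> //; rewrite -(ff b) e scalerDr (CsD c).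
have good_inj b a a' : good b a -> good b a' -> a = a'.
  move=> [Aa fa [c [Cc e]]] [Aa' fa' [c' [Cc' e']]].
  pose n := rr (-1).
  have nK (x : B) : rr 1 *: x = x -> x + n *: x = 0.
    by move=> fx; rewrite -{1}fx; exact: rrNb.
  have z : a + n *: a' = c' + n *: c.
    rewrite -[LHS]addr0 -(nK c) ?CsD // addrACA -e e' addrACA nK // add0r //.
  have h : a + n *: a' = 0.
    apply: CA; first by rewrite z; apply: CD => //; apply: CZ.
    by apply: AD => //; apply: AZ.
  by rewrite -[a]addr0 -(nK a') // [a' + _]addrC addrA h add0r.
have /choice[p pE] := goodE.
have [||P PE] := @ex_linear S B B p.
- move=> x y; apply: (good_inj (x + y)) => //.
  have [Ax fx [c [Cc e]]] := pE x; have [Ay fy [c' [Cc' e']]] := pE y.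
  split; [exact: AD|by rewrite scalerDr fx fy|exists (c + c')].
  by split; [exact: CD|rewrite scalerDr e e' addrACA].
- move=> s x; apply: (good_inj (s *: x)) => //.
  have [Ax fx [c [Cc e]]] := pE x.
  split; [exact: AZ|by rewrite scalerA -rr1_com -scalerA fx|exists (s *: c)].
  by split; [exact: CZ|rewrite scalerA -rr1_com -scalerA e scalerDr].
exists P; split=> [b|a Aa]; rewrite PE; first by have [] := pE b.
apply: (good_inj a) => //; split; [exact: AZ|exact: ff|].
by exists 0; rewrite addr0.
Qed.

Section BooleanSupport.
Variable A : set B.
Hypotheses (sA : subsemimodule A) (tA : subtractive A).

(** For a subsemimodule [A], this is the largest t such that t b lies in [A]. *)
Definition support (b : B) : T :=
  (\join_(t : T | `[< A (tt t *: b) >]) t)%O.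

Lemma supportP t b : A (tt t *: b) <-> (t <= support b)%O.
Proof.
have [A0 AD AZ] := sA.
split=> [At|le]; first by rewrite /support; apply: joins_sup; apply/asboolP.
have As : A (tt (support b) *: b).
  apply: (big_ind (fun t => A (tt t *: b))) => [|u v Au Av|u /asboolP//].
    by rewrite tt_bot scale0r.
  by rewrite ttU scalerDl; apply: AD.
by move/meet_idPl: le => <-; rewrite ttI -scalerA; apply: AZ.
Qed.

Lemma support_eq (u v : T) : (forall t, (t <= u)%O <-> (t <= v)%O) -> u = v.
Proof. by move=> h; apply/le_anti; apply/andP; split; apply/h. Qed.

Lemma tt_addxx t (x : B) : tt t *: x + tt t *: x = tt t *: x.
Proof. by rewrite -scalerDl -ttU joinxx. Qed.

(** If t x + t y is in [A], adding t x or t y does not change it, so subtractivity puts both in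
    [A]. *)
Lemma supportD x y : support (x + y) = (support x `&` support y)%O.
Proof.
have [A0 AD AZ] := sA.
apply: support_eq => t; rewrite lexI -supportP scalerDr.
split=> [Axy|/andP[/supportP Ax /supportP Ay]]; last exact: AD.
apply/andP; split; apply/supportP; apply: (tA Axy).
  by rewrite addrAC tt_addxx.
by rewrite -addrA tt_addxx.
Qed.

Lemma supportZ s x : support (s *: x) = (support x `|` ~` sT s)%O.
Proof.
apply: support_eq => t.
by rewrite -supportP scalerA ttMl supportP leIl_joinC.
Qed.

Lemma support_in x : A x -> support x = \top%O.
Proof.
by move=> Ax; apply/eqP; rewrite -le1x; apply/supportP; case: sA => _ _; exact.
Qed.

Section Extension.
Variables (M : lSemiModType S) (w : M).
Hypothesis wP : forall m, tt \top%O *: m + tt \top%O *: w = tt \top%O *: w.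

Lemma top_absorb t m : tt t *: m + tt t *: w = tt t *: w.
Proof. by rewrite -[t]meetx1 ttI -!scalerA -scalerDr wP. Qed.

(** Complementation turns the meets and joins of supports into sums and scalar multiples. The map
    vanishes on [A] and absorbs the Boolean part of [M] outside the support. *)
Lemma ex_cosupport : exists k : {linear B -> M},
  forall b, k b = tt (~` support b)%O *: w.
Proof.
have [||k kE] := @ex_linear S B M (fun b => tt (~` support b)%O *: w).
- by move=> x y; rewrite supportD complI ttU scalerDl.
- by move=> s x; rewrite supportZ complU complK scalerA ttMr.
by exists k.
Qed.

Lemma extension_exists (h : B -> M) : linear_on A h ->
  exists H : {linear B -> M}, forall x, A x -> H x = h x.
Proof.
move=> [hD hZ]; have [A0 AD AZ] := sA.
have [p [pA pE]] := ring_projection sA; have [k kE] := ex_cosupport.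
have Asup b : A (tt (support b) *: b) by apply/supportP.
pose g b := h (tt (support b) *: b).
have split_top u (m : M) : tt u *: m + tt (~` u)%O *: m = tt \top%O *: m.
  by rewrite -scalerDl -ttU joinxC.
(* Restricting [g x] further to the support of y is invisible after adding [k y]. So g + k is
   additive although [g] alone need not be. *)
have gk x y : h (tt (support y) *: (tt (support x) *: x)) + k y = g x + k y.
  have -> : g x = tt \top%O *: g x.
    by rewrite -hZ // scalerA -ttI meet1x.
  by rewrite -(split_top (support y)) -addrA kE top_absorb -kE hZ.
have [||H HE] := @ex_linear S B M (fun b => h (p b) + (g b + k b)).
- move=> x y; rewrite !linearD hD // [RHS]addrACA; congr (_ + _).
  rewrite {1}/g supportD ttI scalerDr.
  have e : tt (support x) * tt (support y) = tt (support y) * tt (support x).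
    exact: tt_com.
  rewrite {1}e -!scalerA hD; [|exact: AZ|exact: AZ].
  by rewrite [k x + k y]addrC [LHS]addrACA !gk addrACA [k y + k x]addrC [LHS]addrACA.
- move=> s x; rewrite !linearZZ hZ // !scalerDr; congr (_ + (_ + _)).
  rewrite /g -hZ // !scalerA supportZ ttMl ttMr; congr (h (tt _ *: _)).
  by rewrite meetUl meetCx joinx0.
exists H => x Ax; rewrite HE pE // kE /g support_in //.
rewrite compl1 tt_bot scale0r addr0 -hD; [|exact: AZ|exact: AZ].
by rewrite -scalerDl rr1_tt1 scale1r.
Qed.

Lemma extensions_equated (h h' : {linear B -> M}) : (forall x, A x -> h x = h' x) ->
  exists k k' : {linear B -> M},
    [/\ forall x, A x -> k x = 0, forall x, A x -> k' x = 0
      & forall x, h x + k x = h' x + k' x].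
Proof.
move=> hh'; have [A0 AD AZ] := sA; have [k kE] := ex_cosupport.
have k0 x : A x -> k x = 0.
  by move=> Ax; rewrite kE support_in // compl1 tt_bot scale0r.
(* On the ring part [K] is h' - h; on the Boolean part it is [k], which absorbs whatever h and h' do
   outside the support, while inside it they agree. *)
have [||K KE] := @ex_linear S B M
    (fun b => rr (-1) *: h b + rr 1 *: h' b + k b).
- move=> x y; rewrite !linearD !scalerDr [RHS]addrACA; congr (_ + _).
  exact: addrACA.
- move=> s x; rewrite !linearZZ !scalerDr !scalerA.
  by rewrite rrN_com rr1_com.
exists K, k; split=> // [x Ax|x].
  by rewrite KE k0 // addr0 (hh' x Ax) addrC rrNb.
have tk (l : {linear B -> M}) : tt \top%O *: l x + k x = l (tt (support x) *: x) + k x.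
  rewrite -(joinxC (support x)) ttU scalerDl -addrA kE top_absorb.
  by rewrite linearZZ.
have Asup : A (tt (support x) *: x) by apply/supportP.
have dec m : m = tt \top%O *: m + rr 1 *: m :> M.
  by rewrite -scalerDl addrC rr1_tt1 scale1r.
rewrite KE {1}(dec (h x)) [_ + k x in LHS]addrC [LHS]addrACA.
rewrite [rr 1 *: h x + _]addrA rrNb add0r tk hh' // -tk.
by rewrite {3}(dec (h' x)) [RHS]addrAC.
Qed.

End Extension.
End BooleanSupport.
End Module.

Lemma fg_absorbing (M : lSemiModType S) : fg_semimodule M ->
  exists w : M, forall m, tt \top%O *: m + tt \top%O *: w = tt \top%O *: w.
Proof.
have top1 (s : S) : tt \top%O * s + tt \top%O * 1 = tt \top%O * 1.
  rewrite -mulrDr !ttMl !meet1x; congr (tt _).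
  by rewrite /sT rmorphD rmorph1; apply: joinx1.
(* The sum of the generators; each coordinate is absorbed by the top element of the Boolean
   factor. *)
move=> [n [g surj]]; exists (g [ffun=> 1]) => m; have [v <-] := surj m.
rewrite -!linearZZ -linearD; congr (g _); apply/ffunP => i; rewrite !ffunE.
exact: top1.
Qed.

Lemma fg_e_injective (M : lSemiModType S) :
  semisimple_ring R -> fg_semimodule M -> e_injective M.
Proof.
move=> hR /fg_absorbing[w wP]; apply/e_injectiveP; split.
  by move=> B A h sA tA hA; apply: extension_exists wP _ hA.
by move=> B A h h' sA tA hA; apply: extensions_equated wP _ _ hA.
Qed.

End Decomposed.

(** * The implications between the three conditions *)

Lemma cyclic_fg (S : pzSemiRingType) (M : lSemiModType S) :
  cyclic_semimodule M -> fg_semimodule M.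
Proof.
move=> [f surj]; exists 1.
have [||g gE] := @ex_linear S {ffun 'I_1 -> S^o} M (fun v => f (v ord0)).
- by move=> x y; rewrite ffunE linearD.
- by move=> s x; rewrite ffunE linearZZ.
exists g => y; have [x <-] := surj y; exists [ffun=> x].
by rewrite gE ffunE.
Qed.

Theorem theorem6p7 (S : pzSemiRingType) (hS : left_subtractive S) :
  ((forall M : lSemiModType S, fg_semimodule M -> e_injective M) <->
   (forall M : lSemiModType S, cyclic_semimodule M -> e_injective M)) /\
  ((forall M : lSemiModType S, cyclic_semimodule M -> e_injective M) <->
   (exists (R : pzRingType) (d : Order.disp_t) (T : finCTBDistrLatticeType d),
      semisimple_ring R /\
      semiring_iso S (R * boolean_semiring T)%type)).
Proof.
have h12 : (forall M : lSemiModType S, fg_semimodule M -> e_injective M) ->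
    forall M : lSemiModType S, cyclic_semimodule M -> e_injective M.
  by move=> h M /cyclic_fg/h.
have h23 := cyclic_e_injective_decomposition hS.
have h31 : (exists (R : pzRingType) (d : Order.disp_t) (T : finCTBDistrLatticeType d),
      semisimple_ring R /\ semiring_iso S (R * boolean_semiring T)%type) ->
    forall M : lSemiModType S, fg_semimodule M -> e_injective M.
  move=> [R [d [T [hR [f [g fK gK]]]]]] M; exact: (fg_e_injective fK gK hR).
by split; split=> [h|h]; [exact: h12|exact/h31/h23|exact: h23|exact/h12/h31].
Qed.
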